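(* Let $\Gamma<\mathrm{PSL}_2(\mathbb{C})$ be a non-cocompact cofinite discrete group acting on $\mathbb{H}^3$, containing a parabolic element fixing $\infty$, and suppose that $\Gamma$ admits a DF domain $\mathcal{F}$ whose center $P_0\in\mathbb{H}^3$ has trivial stabilizer in $\Gamma$. Then $\mathrm{tr}(\gamma)\in\mathbb{R}$ for every side-pairing transformation $\gamma$ of $\mathcal{F}$, and the vertical planes bisecting $\Sigma_\gamma$ and $\Sigma_{\gamma^{-1}}$, where $\gamma$ runs over the side-pairing transformations of $\mathcal{F}$ with $\gamma\notin\Gamma_\infty$, all intersect in a vertical axis, i.e. there is a vertical line contained in all of these planes.
   Context: $\mathbb{H}^3=\{z+rj: z\in\mathbb{C}, r>0\}$ (inside the Hamilton quaternions) is the upper half-space model with hyperbolic distance $\rho$; $\begin{pmatrix} a&b\\c&d\end{pmatrix}$ acts by $P\mapsto (aP+b)(cP+d)^{-1}$. Elements of $\mathrm{PSL}_2(\mathbb{C})$ are written as matrices of determinant $1$, up to sign (so the trace is defined up to sign). A discrete group is cofinite if it has a fundamental domain of finite volume. $\Gamma_\infty$ is the stabilizer of $\infty$. For a fundamental polyhedron $\mathcal{F}$ and each side $S$ there is $\gamma_S\in\Gamma$ with $S=\mathcal{F}\cap\gamma_S(\mathcal{F})$; these are the side-pairing transformations. Dirichlet domain with center $P_0$ (with trivial stabilizer): $\bigcap_{\gamma\in\Gamma\setminus\{1\}}\{u: \rho(u,P_0)\le\rho(u,\gamma(P_0))\}$. Ford domain (when $\Gamma_\infty$ contains a parabolic element):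 a set $\mathcal{F}_\infty\cap\bigcap_{\gamma\in\Gamma\setminus\Gamma_\infty}\{P: |c(\gamma)P+d(\gamma)|^2\ge1\}$, with $\mathcal{F}_\infty$ some convex fundamental polyhedron of $\Gamma_\infty$ and $(c(\gamma),d(\gamma))$ the lower row of $\gamma$. DF domain: a Dirichlet fundamental domain that is also a Ford domain; its center is the center of the Dirichlet domain. $\Sigma_\gamma=\{u\in\mathbb{H}^3: \rho(u,P_0)=\rho(u,\gamma^{-1}(P_0))\}$ is the bisector relative to the center $P_0$. For a side-pairing transformation $\gamma\notin\Gamma_\infty$ of a DF domain, $\Sigma_\gamma$ and $\Sigma_{\gamma^{-1}}$ are Euclidean (half-)spheres centered in $\mathbb{C}$; when their centers are distinct, the vertical plane bisecting them is the vertical Euclidean plane of points $z+rj$ with $z$ equidistant from the two centers. (When the centers coincide no plane is associated to $\gamma$.) *)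

(* Defs.v *)
From HB Require Import structures.
From mathcomp Require Import all_boot all_order all_algebra.
From mathcomp Require Import complex.
From mathcomp Require Import all_classical all_reals all_analysis.
Set Implicit Arguments.
Unset Strict Implicit.
Unset Printing Implicit Defensive.
Import Order.TTheory GRing.Theory Num.Theory numFieldNormedType.Exports.
Import Normc.
Local Open Scope classical_set_scope.
Local Open Scope complex_scope.
Local Open Scope ring_scope.

(* The Hamilton quaternion z + w j, where j z = z^* j and j^2 = -1. *)
Record quat (R : realType) := Quat { qz : R[i]; qw : R[i] }.

Definition qadd (R : realType) (p q : quat R) : quat R :=
  Quat (qz p + qz q) (qw p + qw q).

Definition qmul (R : realType) (p q : quat R) : quat R :=
  Quat (qz p * qz q - qw p * (qw q)^*) (qz p * qw q + qw p * (qz q)^*).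

Definition qnorm2 (R : realType) (q : quat R) : R :=
  normc (qz q) ^+ 2 + normc (qw q) ^+ 2.

Definition qinv (R : realType) (q : quat R) : quat R :=
  Quat ((qz q)^* / (qnorm2 q)%:C) (- qw q / (qnorm2 q)%:C).

Definition qC (R : realType) (a : R[i]) : quat R := Quat a 0.

(* The triple (x, y, r) stands for the quaternion (x + iy) + rj; it carries the
   product topology and the product Borel sigma-algebra.  Hyperbolic space is
   the open subset [H3] of such triples. *)
Definition zpart (R : realType) (P : R * R * R) : R[i] := P.1.1 +i* P.1.2.

Definition H3 (R : realType) : set (R * R * R) := [set P | 0 < P.2].

Definition quat_of (R : realType) (P : R * R * R) : quat R :=
  Quat (zpart P) (P.2)%:C.

(* The inverse of [quat_of] on quaternions without k-component. *)
Definition of_quat (R : realType) (q : quat R) : R * R * R :=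
  (complex.Re (qz q), complex.Im (qz q), complex.Re (qw q)).

(* c(g) P + d(g) *)
Definition qden (R : realType) (g : 'M[R[i]]_2) (P : R * R * R) : quat R :=
  qadd (qmul (qC (g 1 0)) (quat_of P)) (qC (g 1 1)).

(* P |-> (a P + b) (c P + d)^-1; its value has no k-component when \det g = 1
   and P is in H3. *)
Definition act (R : realType) (g : 'M[R[i]]_2) (P : R * R * R) : R * R * R :=
  of_quat (qmul (qadd (qmul (qC (g 0 0)) (quat_of P)) (qC (g 0 1)))
                (qinv (qden g P))).

(* arcosh of (|z - z'|^2 + r^2 + r'^2) / (2 r r'), with
   arcosh t = ln (t + sqrt (t^2 - 1)). *)
Definition hdist (R : realType) (P Q : R * R * R) : R :=
  let t := (normc (zpart P - zpart Q) ^+ 2 + P.2 ^+ 2 + Q.2 ^+ 2)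
             / (2 * P.2 * Q.2) in
  ln (t + Num.sqrt (t ^+ 2 - 1)).

Definition leb3 (R : realType) : set (R * R * R) -> \bar R :=
  ((@lebesgue_measure R \x @lebesgue_measure R) \x @lebesgue_measure R)%E.

(* The hyperbolic volume, with density dx dy dr / r^3; meant for Borel sets. *)
Definition hvol (R : realType) (D : set (R * R * R)) : \bar R :=
  (\int[(@lebesgue_measure R \x @lebesgue_measure R) \x @lebesgue_measure R]_(P in D)
     (P.2 ^- 3)%:E)%E.

(* A subgroup of PSL_2(C) is represented by its preimage in SL_2(C), i.e. by a
   subgroup of SL_2(C) stable under g |-> - g; the identity of PSL_2(C) is the
   pair {1, -1}. *)
Definition psl2_subgroup (R : realType) (G : set 'M[R[i]]_2) : Prop :=
  [/\ G 1,
      forall g, G g -> \det g = 1,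
      forall g, G g -> G (- g),
      forall g h, G g -> G h -> G (g * h)
    & forall g, G g -> G g^-1].

Definition psl2_trivial (R : realType) (g : 'M[R[i]]_2) : Prop :=
  g = 1 \/ g = -1.

(* Every element is isolated; this is the same in SL_2(C) and in PSL_2(C), the
   projection being a double covering. *)
Definition discrete_group (R : realType) (G : set 'M[R[i]]_2) : Prop :=
  forall g, G g -> exists2 e : R, 0 < e &
    forall h, G h -> (forall i j, normc (h i j - g i j) < e) -> h = g.

Definition closed_in_H3 (R : realType) (D : set (R * R * R)) : Prop :=
  D = closure D `&` @H3 R.

(* The boundary of a set closed in H3. *)
Definition bd (R : realType) (D : set (R * R * R)) : set (R * R * R) :=
  D `\` interior D.

Definition fundamental_domain (R : realType) (G : set 'M[R[i]]_2)
    (D : set (R * R * R)) : Prop :=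
  [/\ closed_in_H3 D,
      @H3 R = \bigcup_(g in G) (act g @` D),
      forall g, G g -> ~ psl2_trivial g ->
        (act g @` interior D) `&` interior D = set0
    & leb3 (bd D) = 0%E].

Definition cofinite (R : realType) (G : set 'M[R[i]]_2) : Prop :=
  exists2 D, fundamental_domain G D & (hvol D < +oo)%E.

Definition cocompact (R : realType) (G : set 'M[R[i]]_2) : Prop :=
  exists2 D, fundamental_domain G D & compact D.

Definition parabolic (R : realType) (g : 'M[R[i]]_2) : Prop :=
  ~ psl2_trivial g /\ (\tr g) ^+ 2 = 4.

(* g sends oo to a / c. *)
Definition fixes_infty (R : realType) (g : 'M[R[i]]_2) : Prop := g 1 0 = 0.

Definition stab_infty (R : realType) (G : set 'M[R[i]]_2) : set 'M[R[i]]_2 :=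
  G `&` [set g | fixes_infty g].

Definition trivial_stabilizer (R : realType) (G : set 'M[R[i]]_2)
    (P0 : R * R * R) : Prop :=
  forall g, G g -> act g P0 = P0 -> psl2_trivial g.

(* The geodesic segment from P to Q. *)
Definition hsegment (R : realType) (P Q : R * R * R) : set (R * R * R) :=
  [set u | H3 u /\ hdist P u + hdist u Q = hdist P Q].

Definition hconvex (R : realType) (D : set (R * R * R)) : Prop :=
  D `<=` @H3 R /\ forall P Q, D P -> D Q -> hsegment P Q `<=` D.

(* The maximal nonempty convex subsets of the boundary. *)
Definition side (R : realType) (D S : set (R * R * R)) : Prop :=
  [/\ S !=set0, hconvex S, S `<=` bd D
    & forall S', hconvex S' -> S' `<=` bd D -> S `<=` S' -> S' = S].

Definition convex_polyhedron (R : realType) (D : set (R * R * R)) : Prop :=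
  [/\ D !=set0, closed_in_H3 D, hconvex D
    & forall P : R * R * R, H3 P -> exists2 U, nbhs P U &
        finite_set [set S | side D S /\ S `&` U !=set0]].

Definition convex_fundamental_polyhedron (R : realType)
    (G : set 'M[R[i]]_2) (D : set (R * R * R)) : Prop :=
  convex_polyhedron D /\ fundamental_domain G D.

Definition side_pairing (R : realType) (G : set 'M[R[i]]_2)
    (F : set (R * R * R)) (g : 'M[R[i]]_2) : Prop :=
  G g /\ side F (F `&` act g @` F).

Definition dirichlet_domain (R : realType) (G : set 'M[R[i]]_2)
    (P0 : R * R * R) : set (R * R * R) :=
  [set u | H3 u /\ forall g, G g -> ~ psl2_trivial g ->
     hdist u P0 <= hdist u (act g P0)].

Definition ford_domain (R : realType) (G : set 'M[R[i]]_2)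
    (F : set (R * R * R)) : Prop :=
  exists2 Finf, convex_fundamental_polyhedron (stab_infty G) Finf &
    F = Finf `&` [set P | forall g, G g -> ~ fixes_infty g ->
                    1 <= qnorm2 (qden g P)].

Definition DF_domain (R : realType) (G : set 'M[R[i]]_2)
    (P0 : R * R * R) (F : set (R * R * R)) : Prop :=
  F = dirichlet_domain G P0 /\ ford_domain G F.

(* Sigma_g, relative to the center P0. *)
Definition bisector (R : realType) (P0 : R * R * R) (g : 'M[R[i]]_2) :
    set (R * R * R) :=
  [set u | H3 u /\ hdist u P0 = hdist u (act g^-1 P0)].

(* S is a Euclidean half-sphere with center z in the plane r = 0. *)
Definition hemisphere_centered (R : realType) (S : set (R * R * R))
    (z : R[i]) : Prop :=
  exists2 r : R, 0 < r &
    S = [set u | H3 u /\ normc (zpart u - z) ^+ 2 + u.2 ^+ 2 = r ^+ 2].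

Definition vertical_line (R : realType) (z : R[i]) : set (R * R * R) :=
  [set u | H3 u /\ zpart u = z].

Definition bisecting_plane (R : realType) (z1 z2 : R[i]) : set (R * R * R) :=
  [set u | H3 u /\ normc (zpart u - z1) = normc (zpart u - z2)].

(* Main.v *)
Require Import Defs.
From mathcomp Require Import all_boot all_order all_algebra.
From mathcomp Require Import complex ring lra.
From mathcomp Require Import all_classical all_reals all_analysis.
Set Implicit Arguments.
Unset Strict Implicit.
Unset Printing Implicit Defensive.
Import Order.TTheory GRing.Theory Num.Theory numFieldNormedType.Exports.
Local Open Scope classical_set_scope.
Local Open Scope ring_scope.

(* In the coordinates (x, y, x^2 + y^2 + r^2) hyperbolic half-spaces become affine
   half-spaces, so a Dirichlet domain is a locally finite convex polyhedron.  If
   g does not fix oo and u, g^-1 u both lie in F, then u lies on the bisector of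
   P0 and g P0 (Dirichlet inequalities for both points) and on the isometric
   sphere of g^-1 (Ford inequalities for both points).
   A side spans a plane, hence bisector and isometric sphere coincide.
   Comparing coefficients, with g^-1 conjugated so that P0 lies above 0, gives
   g^-1 = (A, mu c^*; c, A^* ): the trace 2 Re A is real, and the centres A/c and
   -A^*/c of the two spheres are equidistant from 0, so the common axis is the
   vertical line through P0.  If g fixes oo, discreteness and the parabolic
   element force |a| = 1 for the eigenvalue a of g, so tr g = a + a^* is real. *)

(** * Affine forms, rays and vectors in three real coordinates *)

Definition aeval (R : realType) (L : R * R * R * R) (v : R * R * R) : R :=
  L.1.1.1 + L.1.1.2 * v.1.1 + L.1.2 * v.1.2 + L.2 * v.2.

Definition alin (R : realType) (L : R * R * R * R) (w : R * R * R) : R :=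
  L.1.1.2 * w.1.1 + L.1.2 * w.1.2 + L.2 * w.2.

Definition ray (R : realType) (p w : R * R * R) (e : R) : R * R * R :=
  (p.1.1 + e * w.1.1, p.1.2 + e * w.1.2, p.2 + e * w.2).

Definition vdiff (R : realType) (p q : R * R * R) : R * R * R :=
  (p.1.1 - q.1.1, p.1.2 - q.1.2, p.2 - q.2).

Definition vadd (R : realType) (p q : R * R * R) : R * R * R :=
  (p.1.1 + q.1.1, p.1.2 + q.1.2, p.2 + q.2).

Definition vscale (R : realType) (s : R) (p : R * R * R) : R * R * R :=
  (s * p.1.1, s * p.1.2, s * p.2).

Lemma aeval_ray (R : realType) (L : R * R * R * R) (p w : R * R * R) (e : R) :
  aeval L (ray p w e) = aeval L p + e * alin L w.
Proof. by rewrite /aeval /alin /ray /=; ring. Qed.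

Lemma alin_diff (R : realType) (L : R * R * R * R) (p q : R * R * R) :
  alin L (vdiff p q) = aeval L p - aeval L q.
Proof. by rewrite /aeval /alin /vdiff /=; ring. Qed.

Lemma alinD (R : realType) (L : R * R * R * R) (p q : R * R * R) :
  alin L (vadd p q) = alin L p + alin L q.
Proof. by rewrite /alin /vadd /=; ring. Qed.

Lemma alinZ (R : realType) (L : R * R * R * R) (s : R) (p : R * R * R) :
  alin L (vscale s p) = s * alin L p.
Proof. by rewrite /alin /vscale /=; ring. Qed.

Definition vadd4 (R : realType) (L M : R * R * R * R) : R * R * R * R :=
  (L.1.1.1 + M.1.1.1, L.1.1.2 + M.1.1.2, L.1.2 + M.1.2, L.2 + M.2).

Definition vscale4 (R : realType) (s : R) (L : R * R * R * R) : R * R * R * R :=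
  (s * L.1.1.1, s * L.1.1.2, s * L.1.2, s * L.2).

Lemma aevalD4 (R : realType) (L M : R * R * R * R) (v : R * R * R) :
  aeval (vadd4 L M) v = aeval L v + aeval M v.
Proof. by rewrite /aeval /vadd4 /=; ring. Qed.

Lemma aevalZ4 (R : realType) (s : R) (L : R * R * R * R) (v : R * R * R) :
  aeval (vscale4 s L) v = s * aeval L v.
Proof. by rewrite /aeval /vscale4 /=; ring. Qed.

Lemma ray0 (R : realType) (p w : R * R * R) :
  ray p w 0 = p.
Proof. by rewrite /ray !mul0r !addr0; case: p => [[]]. Qed.

(** * Faces of locally finite convex polyhedra *)

Section LocallyFinitePolyhedron.
Context {R : realType} {I : eqType} (f : I -> R * R * R * R) (D : set I)
  (U : set (R * R * R)) (v0 : R * R * R).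
Hypothesis f_v0 : forall i, D i -> 0 < aeval (f i) v0.
Hypothesis U_mid : forall p q, U p -> U q -> U (ray p (vdiff q p) 2^-1).
(** Local finiteness, tested along rays only: at p, and on a short initial segment of the ray from p
    in direction w, one finite list contains every constraint that can become an obstruction. *)
Hypothesis f_finite : forall p w, U p -> exists2 J : seq I,
  (forall i, D i -> aeval (f i) p <= 0 -> i \in J) &
  exists2 e0 : R, 0 < e0 & forall e, 0 < e <= e0 ->
    U (ray p w e) /\
    forall i, D i -> aeval (f i) (ray p w e) < 0 -> i \in J.

Definition polyhedron : set (R * R * R) :=
  [set v | U v /\ forall i, D i -> 0 <= aeval (f i) v].

Definition face (i : I) : set (R * R * R) :=
  polyhedron `&` [set v | aeval (f i) v = 0].

(** A relative interior point of the face. If a constraint is active at p but positive at some b of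
    the face, it is inactive at the midpoint of p and b, where no new constraint becomes active;
    only finitely many constraints need removing. *)
Lemma face_relint (i0 : I) : face i0 !=set0 ->
  exists2 p, face i0 p & forall i, D i -> aeval (f i) p = 0 -> face i0 `<=` face i.
Proof.
move=> [p0 Fp0]; have [[Up0 p0K] p0i0] := Fp0.
have [J J0 _] := f_finite p0 Up0.
(* [K] lists the constraints that may still be active at p without vanishing on the whole face. *)
suff H : forall (K : seq I) p, face i0 p ->
    (forall i, D i -> aeval (f i) p = 0 -> i \in K \/ face i0 `<=` face i) ->
    exists2 p, face i0 p & forall i, D i -> aeval (f i) p = 0 -> face i0 `<=` face i.
  by apply: (H J p0) => // i Di fi; left; apply: J0; rewrite // fi.
elim=> [|k K IH] p Fp pK.
  by exists p => // i Di /(pK i Di)[].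
have [kF|] := pselect (face i0 `<=` face k).
  apply: (IH p) => // i Di /(pK i Di)[|]; last by right.
  by rewrite inE => /orP[/eqP->|iK]; [right|left].
have [Dk|nDk] := pselect (D k); last first.
  move=> _; apply: (IH p) => // i Di /(pK i Di)[|]; last by right.
  by rewrite inE => /orP[/eqP ik|iK]; [rewrite ik in Di|left].
move=> /existsNP[b /not_implyP[Fb nbk]].
have bk : 0 < aeval (f k) b.
  have [[Ub bP] _] := Fb; rewrite lt0r bP // andbT.
  by apply/negP => /eqP b0; apply: nbk.
have [[Up pP] fip0] := Fp; have [[Ub bP] bi0] := Fb.
have mE i : aeval (f i) (ray p (vdiff b p) 2^-1) = (aeval (f i) p + aeval (f i) b) / 2.
  by rewrite aeval_ray alin_diff; field.
have Fm : face i0 (ray p (vdiff b p) 2^-1).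
  split; last by rewrite /= mE fip0 bi0 addr0 mul0r.
  by split=> [|i Di]; [exact: U_mid|rewrite mE divr_ge0 // addr_ge0 ?pP ?bP].
apply: (IH _ Fm) => i Di; rewrite mE => mi.
have [fip fib] : aeval (f i) p = 0 /\ aeval (f i) b = 0.
  by have := pP i Di; have := bP i Di; lra.
have [|] := pK i Di fip; last by right.
by rewrite inE => /orP[/eqP ik|iK]; [rewrite ik in fib; lra|left].
Qed.

Lemma argmax_seq (g : I -> R) (P : set I) (J : seq I) :
  (exists2 i, i \in J & P i) ->
  exists i, [/\ i \in J, P i & forall j, j \in J -> P j -> g j <= g i].
Proof.
elim: J => [|k J IH]; case=> i; rewrite ?in_nil // => iJ Pi.
have [[k' k'J Pk']|nJ] := pselect (exists2 i, i \in J & P i); last first.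
  exists i; split=> // j; rewrite inE => /orP[/eqP jk|jJ] Pj; last by case: nJ; exists j.
  move: iJ; rewrite inE => /orP[/eqP ik|iJ']; first by rewrite jk ik.
  by case: nJ; exists i.
have [m [mJ Pm mM]] := IH (ex_intro2 _ _ k' k'J Pk').
have [Pk|nPk] := pselect (P k); last first.
  exists m; split=> //; first by rewrite inE mJ orbT.
  by move=> j; rewrite inE => /orP[/eqP->//|]; apply: mM.
case: (leP (g k) (g m)) => km.
  exists m; split=> //; first by rewrite inE mJ orbT.
  by move=> j; rewrite inE => /orP[/eqP->//|]; apply: mM.
exists k; split=> //; first by rewrite inE eqxx.
move=> j; rewrite inE => /orP[/eqP->//|jJ] Pj.
exact: le_trans (mM j jJ Pj) (ltW km).
Qed.

Lemma ray_nonneg_seq (a b : I -> R) (P : set I) (J : seq I) :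
  (forall i, i \in J -> P i -> 0 < a i) ->
  exists2 e1 : R, 0 < e1 & forall i, i \in J -> P i -> forall e, 0 < e <= e1 ->
    0 <= a i + e * b i.
Proof.
elim: J => [|k J IH] Ja; first by exists 1.
have [i iJ|e1 e1_gt0 e1P] := IH.
  by apply: Ja; rewrite inE iJ orbT.
have [Pk|nPk] := pselect (P k); last first.
  by exists e1 => // i; rewrite inE => /orP[/eqP->//|]; apply: e1P.
have ak : 0 < a k by apply: Ja; rewrite ?inE ?eqxx.
(* Adding 1 keeps the denominator of the step bound positive when [b k] is 0. *)
have bk : 0 < `|b k| + 1 by rewrite ltr_wpDl.
exists (Num.min e1 (a k / (`|b k| + 1))).
  by rewrite lt_min e1_gt0 divr_gt0.
move=> i; rewrite inE => /orP[/eqP-> _ e|iJ Pi e]; rewrite le_min => /and3P[e0 ee1 ek]; last first.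
  by apply: e1P; rewrite ?e0.
move: ek; rewrite ler_pdivlMr // => ek.
have := ler_norm (- b k); rewrite normrN => nb.
have : e * - b k <= e * `|b k| by rewrite ler_pM2l.
by move: ek; rewrite mulrDr mulr1 mulrN; lra.
Qed.

(* A point of the face [i0] at which only the constraints that are constant on
   this face are active is moved slightly in a generic direction towards the
   boundary: it lands on a larger face unless [L] is proportional to [f i0]. *)
Lemma maximal_face_spans (i0 : I) (L : R * R * R * R) :
  D i0 -> face i0 !=set0 ->
  (forall i, D i -> face i0 `<=` face i -> face i `<=` face i0) ->
  (forall v, face i0 v -> aeval L v = 0) ->
  forall v, aeval (f i0) v0 * aeval L v = aeval L v0 * aeval (f i0) v.
Proof.
move=> Di0 F0 Fmax FL.
have [p Fp pact] := face_relint F0; have [[Up pP] fip0] := Fp.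
(* The claim holds at [v0] trivially, so only the linear part [l] of the difference of its two sides
   has to vanish. *)
pose l w := aeval L v0 * alin (f i0) w - aeval (f i0) v0 * alin L w.
suff l0 w : l w = 0.
  move=> v; have := l0 (vdiff v v0); rewrite /l !alin_diff; lra.
apply/eqP/negPn/negP => lw.
have [J0 J0P _] := f_finite p Up.
pose act i := D i /\ aeval (f i) p = 0.
(* [g i] is the multiple of v0 - p that cancels the slope of constraint i along w. Correcting by the
   largest one, [g j], makes every active constraint nondecreasing along [w'] and keeps constraint j
   at zero. *)
pose g i := - alin (f i) w / aeval (f i) v0.
have [|j [jJ [Dj pj] jmax]] := @argmax_seq g act J0.
  by exists i0 => //; apply: J0P; rewrite // fip0.
pose w' := vadd (vscale (g j) (vdiff v0 p)) w.
have w'E i : act i -> alin (f i) w' = (g j - g i) * aeval (f i) v0.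
  move=> [Di fip]; rewrite alinD alinZ alin_diff fip subr0 mulrBl /g mulfVK ?opprK //.
  by rewrite gt_eqF // f_v0.
have [J _ [e0 e0_gt0 e0P]] := f_finite w' Up.
have [i _|e1 e1_gt0 e1P] := @ray_nonneg_seq (fun i => aeval (f i) p)
    (fun i => alin (f i) w') [set i | D i /\ aeval (f i) p != 0] J.
  by move=> [Di fip]; rewrite lt0r fip pP.
pose e := Num.min e0 e1.
have e_gt0 : 0 < e by rewrite lt_min e0_gt0.
have [ee0 ee1] : e <= e0 /\ e <= e1 by split; rewrite ge_min lexx ?orbT.
have [|Uq qJ] := e0P e; first by rewrite e_gt0.
have Fq : face j (ray p w' e).
  split; last by rewrite /= aeval_ray pj w'E ?subrr ?mul0r ?mulr0 ?addr0.
  split=> // i Di; rewrite leNgt; apply/negP => qi.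
  have iJ := qJ i Di qi; move: qi; apply/negP; rewrite -leNgt aeval_ray.
  have [fip|fip] := eqVneq (aeval (f i) p) 0; last first.
    by apply: e1P => //; rewrite e_gt0.
  rewrite fip add0r w'E // mulr_ge0 ?(ltW e_gt0) // mulr_ge0 ?(ltW (f_v0 Di)) //.
  by rewrite subr_ge0 jmax // J0P ?fip.
(* By maximality of the face, the moved point still lies on face [i0], so [f i0] and [L] both have
   slope zero along [w']; eliminating [g j] gives l w = 0. *)
have Fq0 := Fmax j Dj (pact j Dj pj) _ Fq.
have [_] := Fq0; rewrite /= aeval_ray fip0 add0r => /eqP.
rewrite mulf_eq0 (gt_eqF e_gt0) /= alinD alinZ alin_diff fip0 subr0 => /eqP q1.
have /eqP := FL _ Fq0; rewrite aeval_ray (FL p Fp) add0r.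
rewrite mulf_eq0 (gt_eqF e_gt0) /= alinD alinZ alin_diff (FL p Fp) subr0 => /eqP q2.
move/eqP: lw; apply; rewrite /l.
have -> : alin (f i0) w = - (g j * aeval (f i0) v0) by lra.
have -> : alin L w = - (g j * aeval L v0) by lra.
by ring.
Qed.

End LocallyFinitePolyhedron.

(** * Hyperbolic distance and segments in affine coordinates *)

Definition klein (R : realType) (u : R * R * R) : R * R * R :=
  (u.1.1, u.1.2, u.1.1 ^+ 2 + u.1.2 ^+ 2 + u.2 ^+ 2).

Definition cosh_hdist (R : realType) (P Q : R * R * R) : R :=
  ((P.1.1 - Q.1.1) ^+ 2 + (P.1.2 - Q.1.2) ^+ 2 + P.2 ^+ 2 + Q.2 ^+ 2)
    / (2 * P.2 * Q.2).

Definition arcosh (R : realType) (t : R) : R := ln (t + Num.sqrt (t ^+ 2 - 1)).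

Lemma normc_sqr (R : realType) (z : R[i]) :
  Normc.normc z ^+ 2 = complex.Re z ^+ 2 + complex.Im z ^+ 2.
Proof. by case: z => a b; rewrite /Normc.normc /= sqr_sqrtr // addr_ge0 ?sqr_ge0. Qed.

Lemma hdistE (R : realType) (P Q : R * R * R) : hdist P Q = arcosh (cosh_hdist P Q).
Proof. by rewrite /hdist normc_sqr. Qed.

Lemma cosh_hdist_ge1 (R : realType) (P Q : R * R * R) :
  H3 P -> H3 Q -> 1 <= cosh_hdist P Q.
Proof.
rewrite /H3 /= => P0 Q0; rewrite /cosh_hdist ler_pdivlMr ?mul1r ?mulr_gt0 //.
have := sqr_ge0 (P.1.1 - Q.1.1); have := sqr_ge0 (P.1.2 - Q.1.2).
by have := sqr_ge0 (P.2 - Q.2); rewrite [in X in X -> _]sqrrB; lra.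
Qed.

Lemma cosh_hdist_eq1 (R : realType) (P Q : R * R * R) :
  H3 P -> H3 Q -> cosh_hdist P Q = 1 -> P = Q.
Proof.
rewrite /H3 /= => P0 Q0 /eqP; rewrite /cosh_hdist.
have d0 : 2 * P.2 * Q.2 != 0 by rewrite gt_eqF ?mulr_gt0.
rewrite -(inj_eq (mulIf d0)) mulfVK // mul1r => /eqP E.
have h1 := sqr_ge0 (P.1.1 - Q.1.1); have h2 := sqr_ge0 (P.1.2 - Q.1.2).
have h3 := sqr_ge0 (P.2 - Q.2).
have h4 : (P.2 - Q.2) ^+ 2 = P.2 ^+ 2 + Q.2 ^+ 2 - 2 * P.2 * Q.2 by ring.
have e1 : P.1.1 - Q.1.1 = 0 by apply/eqP; rewrite -sqrf_eq0; apply/eqP; lra.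
have e2 : P.1.2 - Q.1.2 = 0 by apply/eqP; rewrite -sqrf_eq0; apply/eqP; lra.
have e3 : P.2 - Q.2 = 0 by apply/eqP; rewrite -sqrf_eq0; apply/eqP; lra.
move: e1 e2 e3; case: P {P0 d0 E h1 h2 h3 h4} => [[? ?] ?]; case: Q {Q0} => [[? ?] ?] /=.
by move=> /subr0_eq-> /subr0_eq-> /subr0_eq->.
Qed.

Section Arcosh.
Context {R : realType}.
Implicit Types a b c s t : R.

Lemma arcosh_sqrt t : 1 <= t ->
  [/\ 0 <= Num.sqrt (t ^+ 2 - 1), Num.sqrt (t ^+ 2 - 1) ^+ 2 = t ^+ 2 - 1
    & 0 < t + Num.sqrt (t ^+ 2 - 1)].
Proof.
move=> t1; rewrite sqrtr_ge0 sqr_sqrtr ?subr_ge0 ?expr_ge1 ?(le_trans ler01) //; split=> //.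
by rewrite ltr_wpDr ?sqrtr_ge0 // (lt_le_trans ltr01).
Qed.

Lemma ler_arcosh s t : 1 <= s -> 1 <= t -> (arcosh s <= arcosh t) = (s <= t).
Proof.
have mono (x y : R) : 1 <= x -> x < y -> arcosh x < arcosh y.
  move=> x1 xy; have y1 := le_trans x1 (ltW xy).
  have [_ _ x0] := arcosh_sqrt x1; have [_ _ y0] := arcosh_sqrt y1.
  rewrite ltr_ln ?posrE // ltr_leD // ler_sqrt; last first.
    by rewrite subr_ge0 expr_ge1 ?(le_trans ler01).
  by rewrite lerB // lerXn2r ?nnegrE ?(le_trans ler01) // ltW.
move=> s1 t1; case: (ltgtP s t) => [st|ts|->]; last by rewrite lexx.
  by rewrite ltW // mono.
by apply/negbTE; rewrite -ltNge mono.
Qed.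

(** This is the addition formula for cosh, freed of square roots. The exponentials t + sqrt(t^2 - 1)
    multiply, and so do their inverses t - sqrt(t^2 - 1); averaging the two products gives c - a b =
    sa sb. *)
Lemma arcoshD a b c : 1 <= a -> 1 <= b -> 1 <= c ->
  arcosh a + arcosh b = arcosh c ->
  a * b <= c /\ (c - a * b) ^+ 2 = (a ^+ 2 - 1) * (b ^+ 2 - 1).
Proof.
move=> a1 b1 c1; rewrite /arcosh.
have [] := arcosh_sqrt a1; have [] := arcosh_sqrt b1; have [] := arcosh_sqrt c1.
set sa := Num.sqrt (a ^+ 2 - 1); set sb := Num.sqrt (b ^+ 2 - 1).
set sc := Num.sqrt (c ^+ 2 - 1) => sc0 scE c0 sb0 sbE b0 sa0 saE a0.
rewrite -lnM ?posrE // => /ln_inj; rewrite !posrE mulr_gt0 // => /(_ isT c0) E.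
have E' : (a - sa) * (b - sb) = c - sc.
  apply: (mulfI (lt0r_neq0 c0)); rewrite -{1}E.
  have -> : (a + sa) * (b + sb) * ((a - sa) * (b - sb)) =
    (a ^+ 2 - sa ^+ 2) * (b ^+ 2 - sb ^+ 2) by ring.
  have -> : (c + sc) * (c - sc) = c ^+ 2 - sc ^+ 2 by ring.
  by rewrite saE sbE scE; ring.
have cE : c - a * b = sa * sb by lra.
rewrite cE exprMn saE sbE; split=> //.
by rewrite -subr_ge0 cE mulr_ge0.
Qed.

End Arcosh.

(* In Klein coordinates hyperbolic segments are straight: equality in the
   triangle inequality makes the Gram determinant of the three Minkowski vectors
   (1, x, y, N) / r vanish, and a null vector orthogonal to a timelike one is
   zero. *)
Lemma aeval_hsegment (R : realType) (L : R * R * R * R) (P Q u : R * R * R) :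
  H3 P -> H3 Q -> hsegment P Q u ->
  0 <= aeval L (klein P) -> 0 <= aeval L (klein Q) -> 0 <= aeval L (klein u).
Proof.
move=> P0 Q0 [u0]; rewrite !hdistE.
set a := cosh_hdist P u; set b := cosh_hdist u Q; set c := cosh_hdist P Q.
have a1 : 1 <= a by exact: cosh_hdist_ge1.
have b1 : 1 <= b by exact: cosh_hdist_ge1.
have c1 : 1 <= c by exact: cosh_hdist_ge1.
move=> /(arcoshD a1 b1 c1)[abc gram] LP LQ.
(* If c = 1 the plane of P and Q degenerates, but then a = 1 and u = P. *)
have [cE1|cN1] := eqVneq c 1.
  have aE : a = 1.
    by apply/eqP; rewrite eq_le a1 andbT -cE1 (le_trans _ abc) // ler_peMr // (le_trans ler01).
  by rewrite -(cosh_hdist_eq1 P0 u0 aE).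
have c2 : 0 < c ^+ 2 - 1 by rewrite subr_gt0 exprn_egt1 // lt_neqAle eq_sym cN1.
have ca : 0 <= b * c - a.
  rewrite subr_ge0; apply: (@le_trans _ _ (b * (a * b))).
    rewrite mulrCA ler_peMr ?(le_trans ler01) //.
    by rewrite -expr2 expr_ge1 // (le_trans ler01).
  by rewrite ler_pM2l // (lt_le_trans ltr01).
have cb : 0 <= a * c - b.
  rewrite subr_ge0; apply: (@le_trans _ _ (a * (a * b))).
    rewrite mulrA ler_peMl ?(le_trans ler01) //.
    by rewrite -expr2 expr_ge1 // (le_trans ler01).
  by rewrite ler_pM2l // (lt_le_trans ltr01).
have aD : a * (2 * P.2 * u.2) = (P.1.1 - u.1.1) ^+ 2 + (P.1.2 - u.1.2) ^+ 2 + P.2 ^+ 2 + u.2 ^+ 2.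
  by rewrite mulfVK // gt_eqF ?mulr_gt0.
have bD : b * (2 * u.2 * Q.2) = (u.1.1 - Q.1.1) ^+ 2 + (u.1.2 - Q.1.2) ^+ 2 + u.2 ^+ 2 + Q.2 ^+ 2.
  by rewrite mulfVK // gt_eqF ?mulr_gt0.
have cD : c * (2 * P.2 * Q.2) = (P.1.1 - Q.1.1) ^+ 2 + (P.1.2 - Q.1.2) ^+ 2 + P.2 ^+ 2 + Q.2 ^+ 2.
  by rewrite mulfVK // gt_eqF ?mulr_gt0.
clearbody a b c; move: P0 Q0 u0 LP LQ aD bD cD; rewrite /H3 /aeval /klein /=.
case: P => [[x1 y1] r1]; case: Q => [[x2 y2] r2]; case: u => [[x y] r] /=.
case: L => [[[l0 lx] ly] ln] /=.
set NP := x1 ^+ 2 + _ + _; set NQ := x2 ^+ 2 + _ + _; set NU := x ^+ 2 + _ + _.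
move=> P0 Q0 u0 LP LQ aD bD cD.
(* Solving the Gram system for the vectors p = (1, x, y, N) / r gives (c^2 - 1) u = (b c - a) P + (a
   c - b) Q; [k], [s], [t] are these coefficients with the heights cleared. The error vector w is
   then shown orthogonal to P ([orth]) and null ([null]). *)
pose k := (c ^+ 2 - 1) * r1 * r2; pose s := (b * c - a) * r * r2.
pose t := (a * c - b) * r * r1.
pose we := k - s - t; pose wx := k * x - s * x1 - t * x2.
pose wy := k * y - s * y1 - t * y2; pose wN := k * NU - s * NP - t * NQ.
have orth : wN = 2 * (wx * x1 + wy * y1) - we * NP.
  apply/eqP; rewrite -subr_eq0; apply/eqP.
  transitivity (k * (a * (2 * r1 * r)) - 2 * s * r1 ^+ 2 - t * (c * (2 * r1 * r2))).
    by rewrite aD cD /wN /wx /wy /we /NU /NP /NQ; ring.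
  by rewrite /k /s /t; ring.
have null : wx ^+ 2 + wy ^+ 2 = we * wN.
  apply/eqP; rewrite -subr_eq0; apply/eqP.
  transitivity (k * s * (a * (2 * r1 * r)) + k * t * (b * (2 * r * r2))
     - s * t * (c * (2 * r1 * r2)) - (k * r) ^+ 2 - (s * r1) ^+ 2 - (t * r2) ^+ 2).
    by rewrite aD bD cD /wN /wx /wy /we /NU /NP /NQ; ring.
  transitivity ((r * r1 * r2) ^+ 2 * (c ^+ 2 - 1) *
    ((a ^+ 2 - 1) * (b ^+ 2 - 1) - (c - a * b) ^+ 2)).
    by rewrite /k /s /t; ring.
  by rewrite gram subrr mulr0.
have sum0 : (wx - we * x1) ^+ 2 + (wy - we * y1) ^+ 2 + (we * r1) ^+ 2 = 0.
  transitivity (wx ^+ 2 + wy ^+ 2 - we * (2 * (wx * x1 + wy * y1) - we * NP)).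
    by rewrite /NP; ring.
  by rewrite null orth subrr.
have h1 := sqr_ge0 (wx - we * x1); have h2 := sqr_ge0 (wy - we * y1).
have h3 := sqr_ge0 (we * r1).
have e0 : we = 0.
  have /eqP : (we * r1) ^+ 2 = 0 by lra.
  by rewrite sqrf_eq0 mulf_eq0 (gt_eqF P0) orbF => /eqP.
have x0 : wx = 0.
  have /eqP : (wx - we * x1) ^+ 2 = 0 by lra.
  by rewrite e0 mul0r subr0 sqrf_eq0 => /eqP.
have y0 : wy = 0.
  have /eqP : (wy - we * y1) ^+ 2 = 0 by lra.
  by rewrite e0 mul0r subr0 sqrf_eq0 => /eqP.
have N0 : wN = 0 by rewrite orth e0 x0 y0; ring.
have k0 : 0 < k by rewrite /k !mulr_gt0.
rewrite -(pmulr_rge0 _ k0).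
have -> : k * (l0 + lx * x + ly * y + ln * NU) =
    s * (l0 + lx * x1 + ly * y1 + ln * NP) + t * (l0 + lx * x2 + ly * y2 + ln * NQ)
    + (l0 * we + lx * wx + ly * wy + ln * wN).
  by rewrite /we /wx /wy /wN; ring.
by rewrite e0 x0 y0 N0 !mulr0 !addr0 addr_ge0 // mulr_ge0 // /s /t !mulr_ge0 // ltW.
Qed.

(** * Real and imaginary parts, and the squared modulus as a polynomial *)

Section ReIm.
Context {R : rcfType}.
Implicit Types (x y : R[i]) (r : R).
Local Notation Re := complex.Re.
Local Notation Im := complex.Im.
Local Open Scope complex_scope.

Lemma ReM x y : Re (x * y) = Re x * Re y - Im x * Im y.
Proof. by case: x y => [? ?] [? ?]. Qed.
Lemma ImM x y : Im (x * y) = Re x * Im y + Im x * Re y.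
Proof. by case: x y => [? ?] [? ?]. Qed.
Lemma ReD x y : Re (x + y) = Re x + Re y.
Proof. by case: x y => [? ?] [? ?]. Qed.
Lemma ImD x y : Im (x + y) = Im x + Im y.
Proof. by case: x y => [? ?] [? ?]. Qed.
Lemma ReN x : Re (- x) = - Re x.
Proof. by case: x. Qed.
Lemma ImN x : Im (- x) = - Im x.
Proof. by case: x. Qed.
Lemma ReJ x : Re x^* = Re x.
Proof. by case: x. Qed.
Lemma ImJ x : Im x^* = - Im x.
Proof. by case: x. Qed.
Lemma ReVr r : Re (r%:C)^-1 = r^-1.
Proof. by rewrite -fmorphV. Qed.
Lemma ImVr r : Im (r%:C)^-1 = 0.
Proof. by rewrite -fmorphV. Qed.

Definition reimE := (ReM, ImM, ReD, ImD, ReN, ImN, ReJ, ImJ, ReVr, ImVr).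

Lemma complex_eq x y : Re x = Re y -> Im x = Im y -> x = y.
Proof. by case: x y => [? ?] [? ?] /= -> ->. Qed.

Definition sqn x : R := Re x ^+ 2 + Im x ^+ 2.

Lemma sqnM x y : sqn (x * y) = sqn x * sqn y.
Proof. by rewrite /sqn !reimE; ring. Qed.
Lemma sqn_ge0 x : 0 <= sqn x.
Proof. by rewrite addr_ge0 ?sqr_ge0. Qed.
Lemma sqnN x : sqn (- x) = sqn x.
Proof. by rewrite /sqn !reimE !sqrrN. Qed.
Lemma sqnD x y : sqn (x + y) <= 2 * (sqn x + sqn y).
Proof.
have := sqn_ge0 (x - y); rewrite /sqn !reimE; lra.
Qed.
Lemma sqn_eq0 x : (sqn x == 0) = (x == 0).
Proof.
apply/eqP/eqP => [h|->]; last by rewrite /sqn /= !expr0n addr0.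
have := sqr_ge0 (Re x); have := sqr_ge0 (Im x); move: h; rewrite /sqn => h h1 h2.
by apply: complex_eq; apply/eqP; rewrite -sqrf_eq0 /=; apply/eqP; lra.
Qed.
End ReIm.

(** * Entries of two-by-two matrices of determinant one *)

Section SL2.
Context {K : comUnitRingType}.
Implicit Types g h : 'M[K]_2.

Lemma ord2P (i : 'I_2) : i = 0 \/ i = 1.
Proof. by case: i => [[|[|//]] ?]; [left|right]; apply/val_inj. Qed.

Lemma mxtrace22 g : \tr g = g 0 0 + g 1 1.
Proof.
rewrite /mxtrace !big_ord_recl big_ord0 addr0.
by congr (_ + g _ _); apply/val_inj.
Qed.

Lemma det_mx22 g : \det g = g 0 0 * g 1 1 - g 0 1 * g 1 0.
Proof.
rewrite (expand_det_row g 0) !big_ord_recl big_ord0 /cofactor addr0.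
rewrite !det_mx11 !mxE /= !expr0 expr1 mul1r mulN1r mulrN.
by congr (_ * g _ _ - g _ _ * g _ _); apply/val_inj.
Qed.

Lemma mulmx22E g h i j : (g * h) i j = g i 0 * h 0 j + g i 1 * h 1 j.
Proof.
rewrite mxE !big_ord_recl big_ord0 addr0.
by congr (_ + g _ _ * h _ _); apply/val_inj.
Qed.

Lemma invmx22E g : \det g = 1 ->
  [/\ g^-1 0 0 = g 1 1, g^-1 0 1 = - g 0 1, g^-1 1 0 = - g 1 0 & g^-1 1 1 = g 0 0].
Proof.
move=> dg.
have gu : g \is a GRing.unit by rewrite unitmxE dg unitr1.
have E i j : g i 0 * g^-1 0 j + g i 1 * g^-1 1 j = (i == j)%:R.
  by rewrite -mulmx22E mulrV // mxE.
have := E 0 0; have := E 0 1; have := E 1 0; have := E 1 1.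
rewrite /= => e11 e10 e01 e00.
rewrite det_mx22 in dg.
split; rewrite -[LHS]mul1r -dg.
- transitivity (g 1 1 * (g 0 0 * g^-1 0 0 + g 0 1 * g^-1 1 0)
    - g 0 1 * (g 1 0 * g^-1 0 0 + g 1 1 * g^-1 1 0)); first ring.
  by rewrite e00 e10 /=; ring.
- transitivity (g 1 1 * (g 0 0 * g^-1 0 1 + g 0 1 * g^-1 1 1)
    - g 0 1 * (g 1 0 * g^-1 0 1 + g 1 1 * g^-1 1 1)); first ring.
  by rewrite e01 e11 /=; ring.
- transitivity (g 0 0 * (g 1 0 * g^-1 0 0 + g 1 1 * g^-1 1 0)
    - g 1 0 * (g 0 0 * g^-1 0 0 + g 0 1 * g^-1 1 0)); first ring.
  by rewrite e00 e10 /=; ring.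
- transitivity (g 0 0 * (g 1 0 * g^-1 0 1 + g 1 1 * g^-1 1 1)
    - g 1 0 * (g 0 0 * g^-1 0 1 + g 0 1 * g^-1 1 1)); first ring.
  by rewrite e01 e11 /=; ring.
Qed.
End SL2.

(* [aeval (psi p q) (klein (z + rj))] is |p(z + rj) + q|^2. *)
Definition psi (R : realType) (p q : R[i]) : R * R * R * R :=
  (sqn q, 2 * (complex.Re p * complex.Re q + complex.Im p * complex.Im q),
   2 * (complex.Re p * complex.Im q - complex.Im p * complex.Re q), sqn p).

Lemma psiE (R : realType) (p q : R[i]) (v : R * R * R) :
  aeval (psi p q) v =
  sqn (p * zpart v + q) + sqn p * (v.2 - (v.1.1 ^+ 2 + v.1.2 ^+ 2)).
Proof. by rewrite /aeval /psi /sqn !reimE /=; ring. Qed.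

(** * The action and the distance to an orbit point as affine forms *)

Section Action.
Context {R : realType}.
Implicit Types (g h : 'M[R[i]]_2) (u v P : R * R * R).

Lemma qden_psi g P : qnorm2 (qden g P) = aeval (psi (g 1 0) (g 1 1)) (klein P).
Proof.
rewrite psiE /qnorm2 !normc_sqr /qden /= /klein /sqn /zpart !reimE /=; ring.
Qed.

Lemma psi_gt0 g P : \det g = 1 -> H3 P -> 0 < aeval (psi (g 1 0) (g 1 1)) (klein P).
Proof.
rewrite det_mx22 /H3 /= => dg P0; rewrite psiE /=.
have -> : P.1.1 ^+ 2 + P.1.2 ^+ 2 + P.2 ^+ 2 - (P.1.1 ^+ 2 + P.1.2 ^+ 2) = P.2 ^+ 2 by ring.
have P2 : 0 < P.2 ^+ 2 by rewrite exprn_gt0.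
have [c0|c0] := eqVneq (g 1 0) 0.
  have d0 : g 1 1 != 0.
    apply/eqP => d0; move: dg; rewrite c0 d0 !mulr0 subrr => /esym/eqP.
    by rewrite oner_eq0.
  rewrite c0 mul0r add0r; apply: ltr_wpDr; first by rewrite mulr_ge0 ?sqn_ge0 // ltW.
  by rewrite lt0r sqn_ge0 sqn_eq0 d0.
by rewrite ltr_wpDl ?sqn_ge0 // mulr_gt0 // lt0r sqn_ge0 sqn_eq0 c0.
Qed.

Lemma actE g P (n := aeval (psi (g 1 0) (g 1 1)) (klein P))
    (w := (g 0 0 * zpart P + g 0 1) * (g 1 0 * zpart P + g 1 1)^*%C
          + g 0 0 * (g 1 0)^*%C * ((P.2) ^+ 2)%:C%C) : \det g = 1 -> H3 P ->
 act g P = (complex.Re w / n, complex.Im w / n, P.2 / n).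
Proof.
move=> dg P0; rewrite /act /of_quat /= qden_psi -/n.
have dr := congr1 (@complex.Re R) (det_mx22 g); rewrite dg !reimE /= in dr.
rewrite /w /qden /= -!fmorphV /= /zpart; clearbody n; clear w dg; move: dr.
move: (g 0 0) (g 0 1) (g 1 0) (g 1 1) => [a1 a2] [b1 b2] [c1 c2] [d1 d2] /= dr.
congr (_, _, _); [by ring|by ring|].
by rewrite -[in RHS](mulr1 P.2) [in RHS]dr; ring.
Qed.

(** The last coordinate reflects multiplicativity of the quaternion norm: |gP|^2 = |aP + b|^2 / |cP
    + d|^2. Hence the action is projective in these coordinates. *)
Lemma klein_act g P (n := aeval (psi (g 1 0) (g 1 1)) (klein P))
    (w := (g 0 0 * zpart P + g 0 1) * (g 1 0 * zpart P + g 1 1)^*%C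
          + g 0 0 * (g 1 0)^*%C * ((P.2) ^+ 2)%:C%C) : \det g = 1 -> H3 P ->
  klein (act g P) =
  (complex.Re w / n, complex.Im w / n, aeval (psi (g 0 0) (g 0 1)) (klein P) / n).
Proof.
move=> dg P0; have n0 : 0 < n by exact: psi_gt0.
rewrite (actE dg P0) -/n -/w /klein /=; congr (_, _, _).
have dr := congr1 (@complex.Re R) (det_mx22 g); rewrite dg !reimE /= in dr.
have di := congr1 (@complex.Im R) (det_mx22 g); rewrite dg !reimE /= in di.
have key : complex.Re w ^+ 2 + complex.Im w ^+ 2 + P.2 ^+ 2 =
    aeval (psi (g 0 0) (g 0 1)) (klein P) * n.
  (* The identity is polynomial for every matrix once [P.2 ^+ 2] is multiplied by |det|^2, so 1 and
     0 are replaced by the real and imaginary parts of the determinant. *)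
  rewrite -[P.2 ^+ 2]mulr1 -(expr1n _ 2) [in LHS]dr -[X in X = _]addr0.
  rewrite -(mulr0 (P.2 ^+ 2 * 0)) [X in _ + P.2 ^+ 2 * X * _ = _]di [X in _ + _ * X = _]di.
  by rewrite /w /n !psiE /klein /sqn !reimE /=; ring.
rewrite !expr_div_n -!mulrDl key expr2 invfM mulrA mulfK //.
exact: lt0r_neq0.
Qed.

(** The cocycle rule: p(gP) + q equals (p, q) g (P, 1)^T divided on the right by cP + d. *)
Lemma psi_act g P p q : \det g = 1 -> H3 P ->
  aeval (psi p q) (klein (act g P)) * aeval (psi (g 1 0) (g 1 1)) (klein P) =
  aeval (psi (p * g 0 0 + q * g 1 0) (p * g 0 1 + q * g 1 1)) (klein P).
Proof.
move=> dg P0; have n0 := psi_gt0 dg P0; rewrite (klein_act dg P0).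
set n := aeval _ _ in n0 *.
transitivity (sqn q * n + (psi p q).1.1.2 * complex.Re
  ((g 0 0 * zpart P + g 0 1) * (g 1 0 * zpart P + g 1 1)^*%C
          + g 0 0 * (g 1 0)^*%C * ((P.2) ^+ 2)%:C%C) + (psi p q).1.2 * complex.Im
  ((g 0 0 * zpart P + g 0 1) * (g 1 0 * zpart P + g 1 1)^*%C
          + g 0 0 * (g 1 0)^*%C * ((P.2) ^+ 2)%:C%C)
  + sqn p * aeval (psi (g 0 0) (g 0 1)) (klein P)).
  by rewrite {1}/aeval /=; field; exact: lt0r_neq0.
by rewrite /n !psiE /psi /klein /sqn /= !reimE /=; ring.
Qed.

Lemma act_H3 g P : \det g = 1 -> H3 P -> H3 (act g P).
Proof.
move=> dg P0; rewrite (actE dg P0) /H3 /= divr_gt0 //; exact: psi_gt0.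
Qed.

(* [Phi P0 h u] is 2 r r0 cosh d(u, h^-1 P0), for u = z + rj. *)
Definition Phi P0 h : R * R * R * R :=
  vadd4 (psi (h 0 0 - zpart P0 * h 1 0) (h 0 1 - zpart P0 * h 1 1))
        (vscale4 (P0.2 ^+ 2) (psi (h 1 0) (h 1 1))).

Lemma aevalPhi P0 h v : aeval (Phi P0 h) v =
  aeval (psi (h 0 0 - zpart P0 * h 1 0) (h 0 1 - zpart P0 * h 1 1)) v
  + P0.2 ^+ 2 * aeval (psi (h 1 0) (h 1 1)) v.
Proof. by rewrite aevalD4 aevalZ4. Qed.

Lemma cosh_hdist_act P0 g u : \det g = 1 -> H3 P0 -> H3 u ->
  cosh_hdist u (act g P0) = aeval (Phi P0 g^-1) (klein u) / (2 * u.2 * P0.2).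
Proof.
move=> dg P00 u0; have n0 := psi_gt0 dg P00.
have -> : cosh_hdist u (act g P0) =
   ((klein u).2 + (klein (act g P0)).2 - 2 * (u.1.1 * (klein (act g P0)).1.1
     + u.1.2 * (klein (act g P0)).1.2)) / (2 * u.2 * (act g P0).2).
  by rewrite /cosh_hdist; congr (_ / _); rewrite /klein /=; ring.
rewrite (klein_act dg P00) (actE dg P00) /=.
set n := aeval _ _ in n0 *.
have [i00 i01 i10 i11] := invmx22E dg.
rewrite aevalPhi i00 i01 i10 i11.
set w := (X in complex.Re X).
have -> : aeval (psi (g 1 1 - zpart P0 * - g 1 0) (- g 0 1 - zpart P0 * g 0 0)) (klein u)
   + P0.2 ^+ 2 * aeval (psi (- g 1 0) (g 0 0)) (klein u) =
   n * (klein u).2 + aeval (psi (g 0 0) (g 0 1)) (klein P0)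
     - 2 * (u.1.1 * complex.Re w + u.1.2 * complex.Im w).
  by rewrite /n /w !psiE /psi /klein /sqn /= !reimE /=; ring.
rewrite -!/w [klein u]/klein /=; clearbody w n.
by field; rewrite ?(lt0r_neq0 n0) ?(lt0r_neq0 u0) ?(lt0r_neq0 P00).
Qed.

Lemma cosh_hdist_Phi P0 u : H3 P0 -> H3 u ->
  cosh_hdist u P0 = aeval (Phi P0 1) (klein u) / (2 * u.2 * P0.2).
Proof.
move=> _ _; rewrite /cosh_hdist; congr (_ / _).
by rewrite aevalPhi !psiE /klein /sqn !mxE !reimE /=; ring.
Qed.

Lemma Phi_act P0 g h v : \det g = 1 -> H3 v ->
  aeval (Phi P0 h) (klein (act g v)) * aeval (psi (g 1 0) (g 1 1)) (klein v) =
  aeval (Phi P0 (h * g)) (klein v).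
Proof.
move=> dg v0; rewrite !aevalPhi mulrDl -mulrA !psi_act // !mulmx22E.
by congr (aeval (psi _ _) _ + _); ring.
Qed.

Lemma hdist_act_le P0 g u : \det g = 1 -> H3 P0 -> H3 u ->
  (hdist u P0 <= hdist u (act g P0)) =
  (aeval (Phi P0 1) (klein u) <= aeval (Phi P0 g^-1) (klein u)).
Proof.
move=> dg P00 u0; have c0 : 0 < 2 * u.2 * P0.2 by rewrite !mulr_gt0.
have gP0 := act_H3 dg P00; rewrite !hdistE ler_arcosh ?cosh_hdist_ge1 //.
by rewrite cosh_hdist_act // cosh_hdist_Phi // ler_pM2r // invr_gt0.
Qed.

Lemma hdist_act_eq P0 g u : \det g = 1 -> H3 P0 -> H3 u ->
  hdist u P0 = hdist u (act g P0) <->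
  aeval (Phi P0 1) (klein u) = aeval (Phi P0 g^-1) (klein u).
Proof.
move=> dg P00 u0; have c0 : 0 < 2 * u.2 * P0.2 by rewrite !mulr_gt0.
have E : (hdist u (act g P0) <= hdist u P0) =
    (aeval (Phi P0 g^-1) (klein u) <= aeval (Phi P0 1) (klein u)).
  have gP0 := act_H3 dg P00; rewrite !hdistE ler_arcosh ?cosh_hdist_ge1 //.
  by rewrite cosh_hdist_act // cosh_hdist_Phi // ler_pM2r // invr_gt0.
by split=> /eqP; rewrite eq_le => h; apply/eqP; rewrite eq_le;
   move: h; rewrite hdist_act_le // E.
Qed.

Lemma Phi_center_gt P0 h : \det h = 1 -> H3 P0 -> act h^-1 P0 <> P0 ->
  aeval (Phi P0 1) (klein P0) < aeval (Phi P0 h) (klein P0).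
Proof.
move=> dh P00 hP.
have dhi : \det h^-1 = 1 by rewrite det_inv dh invr1.
have c0 : 0 < 2 * P0.2 * P0.2 by rewrite !mulr_gt0.
have hP0 := act_H3 dhi P00.
have E1 := cosh_hdist_act dhi P00 P00; rewrite invrK in E1.
have E2 := cosh_hdist_Phi P00 P00.
have E0 : cosh_hdist P0 P0 = 1.
  rewrite /cosh_hdist; field; exact: lt0r_neq0.
have lt1 : 1 < cosh_hdist P0 (act h^-1 P0).
  rewrite lt_neqAle cosh_hdist_ge1 // andbT eq_sym; apply/eqP => e1.
  by apply: hP; exact/esym/(cosh_hdist_eq1 P00 hP0 e1).
by move: lt1; rewrite -E0 E1 E2 ltr_pM2r // invr_gt0.
Qed.
End Action.

(** * Local finiteness of the Dirichlet inequalities *)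

Section Finiteness.
Context {R : realType}.
Implicit Types (g h : 'M[R[i]]_2) (v P : R * R * R).

Lemma truncn_eq_dist (x y : R) : 0 <= x -> 0 <= y ->
  Num.truncn x = Num.truncn y -> (x - y) ^+ 2 < 1.
Proof.
move=> x0 y0 xy; have /andP[x1 x2] := truncn_itv x0.
have /andP[] := truncn_itv y0; rewrite -xy => y1 y2.
rewrite -natr1 in x2 y2; move: (Num.truncn x)%:R x1 x2 y1 y2 => n x1 x2 y1 y2.
have : 0 < (1 - (x - y)) * (1 + (x - y)) by rewrite mulr_gt0 //; lra.
lra.
Qed.

(** Pigeonhole: the bounded region of matrices is cut into finitely many cells of side [eta]. Two
    group elements g, h in one cell have g^-1 h within e of the identity, hence coincide. *)
Lemma discrete_bounded_finite (G : set 'M[R[i]]_2) (M : R) :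
  psl2_subgroup G -> discrete_group G ->
  finite_set [set h | G h /\ forall i j, sqn (h i j) <= M].
Proof.
move=> [G1 Gdet GN GM GV] /(_ 1 G1)[e e0 He].
set B := [set h | _].
have [M0|M0] := ltP M 0.
  apply: (sub_finite_set _ (@finite_set0 'M[R[i]]_2)) => h [_ /(_ 0 0)].
  by have := sqn_ge0 (h 0 0) => h1 h2; have := le_lt_trans (le_trans h1 h2) M0; rewrite ltxx.
(* The 8 in [etaM] collects a 2 from [sqnD], two terms in each entry of the product, and two real
   coordinates in each entry. *)
pose eta := e / (8 * (M + 1)).
have M1 : 0 < M + 1 by rewrite ltr_wpDl.
have eta0 : 0 < eta by rewrite divr_gt0 // mulr_gt0.
have etaM : 8 * M * eta ^+ 2 < e ^+ 2.
  have -> : e = eta * (8 * (M + 1)) by rewrite /eta mulfVK // gt_eqF ?mulr_gt0.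
  have : 0 < eta ^+ 2 by rewrite exprn_gt0.
  by nra.
(* Since x^2 <= M forces |x| <= M + 1, the shift makes the argument of [truncn] nonnegative, where
   it is the floor. *)
pose c (x : R) := (x + M + 1) / eta.
have c_ge0 (x : R) : x ^+ 2 <= M -> 0 <= c x.
  by move=> xM; rewrite divr_ge0 ?(ltW eta0) //; nra.
have c_le (x : R) : x ^+ 2 <= M -> c x <= 2 * (M + 1) / eta.
  by move=> xM; rewrite ler_pM2r ?invr_gt0 //; nra.
pose K := Num.truncn (2 * (M + 1) / eta).
have c_inj (x y : R) : x ^+ 2 <= M -> y ^+ 2 <= M ->
    inord (Num.truncn (c x)) = inord (Num.truncn (c y)) :> 'I_K.+1 ->
    (x - y) ^+ 2 < eta ^+ 2.
  move=> xM yM /(congr1 val); rewrite /= !inordK ?ltnS ?le_truncn ?c_le // => E.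
  have := truncn_eq_dist (c_ge0 _ xM) (c_ge0 _ yM) E.
  rewrite /c -mulrBl exprMn exprVn ltr_pdivrMr ?exprn_gt0 // mul1r.
  by congr (_ ^+ 2 < _); ring.
pose code h : {ffun 'I_2 * 'I_2 -> 'I_K.+1 * 'I_K.+1} :=
  [ffun ij => (inord (Num.truncn (c (complex.Re (h ij.1 ij.2)))),
               inord (Num.truncn (c (complex.Im (h ij.1 ij.2)))))].
have B_re h i j : B h -> complex.Re (h i j) ^+ 2 <= M.
  move=> [_ /(_ i j)]; apply: le_trans; by rewrite /sqn lerDl sqr_ge0.
have B_im h i j : B h -> complex.Im (h i j) ^+ 2 <= M.
  move=> [_ /(_ i j)]; apply: le_trans; by rewrite /sqn lerDr sqr_ge0.
have code_inj : {in B &, injective code}.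
  move=> g h /set_mem Bg /set_mem Bh gh.
  have close i j : sqn (h i j - g i j) <= 2 * eta ^+ 2.
    have := congr1 (fun F : {ffun _ -> _} => F (i, j)) gh.
    rewrite !ffunE /= => -[/esym Er /esym Ei].
    have := c_inj _ _ (B_re _ i j Bh) (B_re _ i j Bg) Er.
    have := c_inj _ _ (B_im _ i j Bh) (B_im _ i j Bg) Ei.
    by rewrite /sqn !reimE; lra.
  have dg := Gdet _ Bg.1.
  have gu : g \is a GRing.unit by rewrite unitmxE dg unitr1.
  have E1 : g^-1 * h = 1.
    apply: He; first by apply: GM; [apply: GV; exact: Bg.1|exact: Bh.1].
    move=> i j; have -> : (g^-1 * h) i j - (1 : 'M[R[i]]_2) i j =
        g^-1 i 0 * (h 0 j - g 0 j) + g^-1 i 1 * (h 1 j - g 1 j).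
      rewrite -{1}(mulVr gu) !mulmx22E; ring.
    have gM k : sqn (g^-1 i k) <= M.
      have [i00 i01 i10 i11] := invmx22E dg.
      have [gB H] := Bg.
      case: (ord2P i) => ->; case: (ord2P k) => ->; rewrite ?i00 ?i01 ?i10 ?i11 ?sqnN; exact: H.
    have pos k : sqn (g^-1 i k * (h k j - g k j)) <= M * (2 * eta ^+ 2).
      by rewrite sqnM ler_pM ?sqn_ge0.
    rewrite -(ltr_pXn2r (n := 2)) ?nnegrE ?(ltW e0) //; last first.
      by case: (_ + _) => ? ?; exact: sqrtr_ge0.
    rewrite normc_sqr; apply: le_lt_trans (sqnD _ _) _.
    have := pos 0; have := pos 1; lra.
  by rewrite -[RHS]mul1r -(mulrV gu) -mulrA E1 mulr1.
have fim : finite_set (code @` B) by exact: finite_finset.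
by rewrite -(eq_finite_set (inj_card_eq code_inj)).
Qed.

(** With tau the squared height, the form is a sum of nonnegative terms |A|^2 tau + |Az + B|^2 +
    r0^2 (|c|^2 tau + |cz + d|^2). Bounding it with tau >= m bounds A and c, then B and d as z is
    bounded, and finally the upper row. *)
Lemma Phi_bound P0 (m Z C : R) : H3 P0 -> 0 < m -> exists M : R, forall h v,
  m <= v.2 - (v.1.1 ^+ 2 + v.1.2 ^+ 2) -> v.1.1 ^+ 2 + v.1.2 ^+ 2 <= Z ->
  aeval (Phi P0 h) v <= C -> forall i j, sqn (h i j) <= M.
Proof.
move=> P00 m0; have r0 : 0 < P0.2 ^+ 2 by rewrite exprn_gt0.
set z0 := zpart P0; set r2 := P0.2 ^+ 2 in r0.
(* The four summands bound |A|^2, |c|^2, |Az + B|^2 and |cz + d|^2 respectively. *)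
pose K := C / m + C / (r2 * m) + C + C / r2.
exists (4 * (1 + sqn z0) * (K * (1 + Z))) => h v.
set tau := v.2 - _ => mtau zZ; rewrite aevalPhi !psiE -/z0 -/r2 -/tau.
set z := zpart v; rewrite -[_ + _ ^+ 2]/(sqn z) in zZ.
set A := h 0 0 - _; set B := h 0 1 - _ => le_C.
have tau0 : 0 < tau by exact: lt_le_trans mtau.
have sA := sqn_ge0 A; have sc := sqn_ge0 (h 1 0).
have sAB := sqn_ge0 (A * z + B); have scd := sqn_ge0 (h 1 0 * z + h 1 1).
have pA : 0 <= sqn A * tau by rewrite mulr_ge0 // ltW.
have pc : 0 <= sqn (h 1 0) * tau by rewrite mulr_ge0 // ltW.
have p1 := mulr_ge0 (ltW r0) pc; have p2 := mulr_ge0 (ltW r0) scd.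
clearbody tau; rewrite mulrDr in le_C.
have C0 : 0 <= C by lra.
have q1 : 0 <= C / m by rewrite divr_ge0 // ltW.
have q2 : 0 <= C / (r2 * m) by rewrite divr_ge0 // mulr_ge0 // ltW.
have q3 : 0 <= C / r2 by rewrite divr_ge0 // ltW.
have kA : sqn A <= K.
  suff : sqn A <= C / m by rewrite /K; lra.
  rewrite ler_pdivlMr //; apply: le_trans (_ : sqn A * tau <= _); last lra.
  by rewrite ler_wpM2l.
have kc : sqn (h 1 0) <= K.
  suff : sqn (h 1 0) <= C / (r2 * m) by rewrite /K; lra.
  rewrite ler_pdivlMr ?mulr_gt0 // mulrCA.
  apply: le_trans (_ : r2 * (sqn (h 1 0) * tau) <= _); last lra.
  by rewrite ler_wpM2l ?(ltW r0) // ler_wpM2l.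
have kAB : sqn (A * z + B) <= K by rewrite /K; lra.
have kcd : sqn (h 1 0 * z + h 1 1) <= K.
  suff : sqn (h 1 0 * z + h 1 1) <= C / r2 by rewrite /K; lra.
  by rewrite ler_pdivlMr // mulrC; lra.
have K0 : 0 <= K by exact: le_trans kA.
clearbody K; have Z0 : 0 <= Z by exact: le_trans (sqn_ge0 z) zZ.
have s0 := sqn_ge0 z0.
have bound (x y : R[i]) : sqn x <= K -> sqn (x * z + y) <= K -> sqn y <= 2 * (K * (1 + Z)).
  move=> xK xyK; have -> : y = (x * z + y) + (- (x * z)) by ring.
  apply: le_trans (sqnD _ _) _; rewrite sqnN sqnM.
  have : sqn x * sqn z <= K * Z by rewrite ler_pM ?sqn_ge0.
  by lra.
have kB := bound _ _ kA kAB; have kd := bound _ _ kc kcd.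
have KZ0 : 0 <= K * (1 + Z) by rewrite mulr_ge0 // addr_ge0.
have KKZ : K <= K * (1 + Z) by rewrite ler_peMr // lerDl.
have bound2 (x y : R[i]) : sqn (x - z0 * y) <= 2 * (K * (1 + Z)) ->
    sqn y <= 2 * (K * (1 + Z)) -> sqn x <= 4 * (1 + sqn z0) * (K * (1 + Z)).
  move=> xK yK; have -> : x = (x - z0 * y) + z0 * y by ring.
  apply: le_trans (sqnD _ _) _; rewrite sqnM.
  have : sqn z0 * sqn y <= sqn z0 * (2 * (K * (1 + Z))) by rewrite ler_wpM2l.
  by nra.
have le4 (y : R) : y <= 2 * (K * (1 + Z)) -> y <= 4 * (1 + sqn z0) * (K * (1 + Z)).
  have : 0 <= sqn z0 * (K * (1 + Z)) by rewrite mulr_ge0.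
  by lra.
move=> i j.
case: (ord2P i) => ->; case: (ord2P j) => ->.
- by apply: bound2 (h 1 0) _ _; rewrite -/A; lra.
- by apply: bound2 (h 1 1) _ _; rewrite -/B.
- by apply: le4; lra.
- exact: le4.
Qed.

(** The image of [H3] under [klein]: the region above a paraboloid. *)
Definition kdomain : set (R * R * R) := [set v | v.1.1 ^+ 2 + v.1.2 ^+ 2 < v.2].

(* [0 <= aeval (gap P0 h) (klein u)] says that u is not farther from P0 than from
   h^-1 P0. *)
Definition gap P0 h : R * R * R * R := vadd4 (Phi P0 h) (vscale4 (-1) (Phi P0 1)).

Lemma aeval_gap P0 h v : aeval (gap P0 h) v = aeval (Phi P0 h) v - aeval (Phi P0 1) v.
Proof. by rewrite aevalD4 aevalZ4 mulN1r. Qed.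

(** The squared height is quadratic along a ray, so it stays above half its initial value for a
    short time. This supplies the uniform lower bound m of [Phi_bound]. *)
Lemma ray_kdomain (p w : R * R * R) : kdomain p -> exists2 e0 : R, 0 < e0 <= 1 &
  forall e, 0 <= e <= e0 ->
  (p.2 - (p.1.1 ^+ 2 + p.1.2 ^+ 2)) / 2 <=
    (ray p w e).2 - ((ray p w e).1.1 ^+ 2 + (ray p w e).1.2 ^+ 2).
Proof.
case: p => [[x y] N]; case: w => [[wx wy] wN]; rewrite /kdomain /= => pN.
pose t0 := N - (x ^+ 2 + y ^+ 2); pose t1 := wN - 2 * (x * wx + y * wy).
pose t2 := wx ^+ 2 + wy ^+ 2.
have t00 : 0 < t0 by rewrite subr_gt0.
have t20 : 0 <= t2 by rewrite addr_ge0 ?sqr_ge0.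
have d0 : 0 < 2 * (`|t1| + t2 + 1) by rewrite mulr_gt0 // ltr_wpDl // addr_ge0.
exists (Num.min 1 (t0 / (2 * (`|t1| + t2 + 1)))).
  by rewrite lt_min ltr01 divr_gt0 //= ge_min lexx.
move=> e; rewrite le_min ler_pdivlMr // => /and3P[e0 e1 ed].
have n1 := ler_norm (- t1); rewrite normrN in n1.
have E : N + e * wN - ((x + e * wx) ^+ 2 + (y + e * wy) ^+ 2) =
  t0 + e * t1 - e ^+ 2 * t2 by rewrite /t0 /t1 /t2; ring.
rewrite E -/t0.
have h1 : e * - t1 <= e * `|t1| by rewrite ler_wpM2l.
have h2 : e ^+ 2 * t2 <= e * t2 by rewrite ler_wpM2r // expr2 ler_piMl.
have := mulr_ge0 e0 t20; lra.
Qed.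

(** On a short ray z and [Phi P0 1] are bounded and the height is bounded below; a nonpositive gap
    thus bounds [Phi P0 h], hence the entries of h, and discreteness leaves finitely many h. *)
Lemma gap_locally_finite (G : set 'M[R[i]]_2) P0 (p w : R * R * R) :
  psl2_subgroup G -> discrete_group G -> H3 P0 -> kdomain p ->
  exists2 J : seq 'M[R[i]]_2,
  (forall h, G h -> aeval (gap P0 h) p <= 0 -> h \in J) &
  exists2 e0 : R, 0 < e0 & forall e, 0 < e <= e0 ->
    kdomain (ray p w e) /\
    forall h, G h -> aeval (gap P0 h) (ray p w e) < 0 -> h \in J.
Proof.
move=> sG dG P00 Up; have [e0 /andP[e0_gt0 e01] e0P] := ray_kdomain w Up.
have [] := Phi_bound (2 * (p.1.1 ^+ 2 + w.1.1 ^+ 2 + p.1.2 ^+ 2 + w.1.2 ^+ 2))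
  (`|aeval (Phi P0 1) p| + `|alin (Phi P0 1) w|) P00
  (_ : 0 < (p.2 - (p.1.1 ^+ 2 + p.1.2 ^+ 2)) / 2).
  by rewrite divr_gt0 // subr_gt0.
move=> M MP.
have /finite_seqP[J JE] := discrete_bounded_finite M sG dG.
have inJ e h : 0 <= e <= e0 -> G h -> aeval (gap P0 h) (ray p w e) <= 0 -> h \in J.
  move=> /[dup] ee /andP[e_ge0 ee0] Gh; rewrite aeval_gap subr_le0 => le_Phi.
  suff : [set` J] h by [].
  rewrite -JE; split=> //; apply: (MP _ _ (e0P e ee)).
    have e1 : e ^+ 2 <= 1 by rewrite expr_le1 // (le_trans ee0).
    have sq (a b : R) : (a + e * b) ^+ 2 <= 2 * (a ^+ 2 + b ^+ 2).
      have := sqr_ge0 (a - e * b); have : (e * b) ^+ 2 <= b ^+ 2.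
        by rewrite exprMn ler_piMl ?sqr_ge0.
      by lra.
    by rewrite /ray /=; have := sq p.1.1 w.1.1; have := sq p.1.2 w.1.2; lra.
  apply: le_trans le_Phi _; rewrite aeval_ray lerD ?ler_norm //.
  apply: le_trans (ler_norm _) _; rewrite normrM ger0_norm // ler_piMl //.
  exact: le_trans ee0 e01.
exists J.
  move=> h Gh; rewrite -[p in aeval _ p](ray0 p w); apply: inJ => //.
  by rewrite lexx ltW.
exists e0 => // e /andP[e_gt0 ee0]; split.
  rewrite /kdomain /= -subr_gt0; apply: lt_le_trans (e0P e _); last by rewrite ltW.
  by rewrite divr_gt0 // subr_gt0.
by move=> h Gh /ltW; apply: inJ; rewrite // ltW.
Qed.

End Finiteness.

(** * The inverse chart, and convergence along rays *)

Section Klein.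
Context {R : realType}.
Implicit Types p q u v w : R * R * R.

Definition unklein v : R * R * R :=
  (v.1.1, v.1.2, Num.sqrt (v.2 - (v.1.1 ^+ 2 + v.1.2 ^+ 2))).

Lemma klein_kdomain u : H3 u -> kdomain (klein u).
Proof. by rewrite /H3 /kdomain /= => u0; rewrite ltrDl exprn_gt0. Qed.

Lemma unklein_H3 v : kdomain v -> H3 (unklein v).
Proof. by rewrite /H3 /kdomain /= => u0; rewrite sqrtr_gt0 subr_gt0. Qed.

Lemma kleinK u : H3 u -> unklein (klein u) = u.
Proof.
case: u => [[x y] r]; rewrite /H3 /unklein /= => r0.
have -> : x ^+ 2 + y ^+ 2 + r ^+ 2 - (x ^+ 2 + y ^+ 2) = r ^+ 2 by ring.
by rewrite sqrtr_sqr gtr0_norm.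
Qed.

Lemma unkleinK v : kdomain v -> klein (unklein v) = v.
Proof.
case: v => [[x y] N]; rewrite /kdomain /klein /= => xyN.
by rewrite sqr_sqrtr ?subr_ge0 ?(ltW xyN) // addrC subrK.
Qed.

Lemma kdomain_mid p q : kdomain p -> kdomain q -> kdomain (ray p (vdiff q p) 2^-1).
Proof.
case: p => [[x y] N]; case: q => [[x' y'] N']; rewrite /kdomain /= => h h'.
have := sqr_ge0 (x - x'); have := sqr_ge0 (y - y'); lra.
Qed.

Lemma unklein_ray_cvg u w : H3 u ->
  unklein (ray (klein u) w e) @[e --> 0^'+] --> u.
Proof.
move=> u0; have uE : u = unklein (ray (klein u) w 0) by rewrite ray0 kleinK.
rewrite [X in _ --> X]uE.
have lin (a b : R) : (a + e * b) @[e --> 0^'+] --> a + 0 * b.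
  by apply: cvgD; [exact: cvg_cst|apply: cvgMl; exact: cvg_at_right_filter].
have sq (a b : R) : (a + e * b) ^+ 2 @[e --> 0^'+] --> (a + 0 * b) ^+ 2.
  by apply: cvgM; exact: lin.
rewrite /unklein /ray /=.
have inner : ((klein u).2 + e * w.2 - ((u.1.1 + e * w.1.1) ^+ 2 + (u.1.2 + e * w.1.2) ^+ 2))
    @[e --> 0^'+] --> (klein u).2 + 0 * w.2 - ((u.1.1 + 0 * w.1.1) ^+ 2 + (u.1.2 + 0 * w.1.2) ^+ 2).
  by apply: (@cvgB R R^o); [exact: lin|apply: cvgD; exact: sq].
exact: cvg_pair (cvg_pair (lin _ _) (lin _ _)) (cvg_comp _ _ inner (@sqrt_continuous R _)).
Qed.

End Klein.

(** * Sides of the Dirichlet domain and the Ford inequalities *)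

Section Sides.
Context {R : realType} (G : set 'M[R[i]]_2) (P0 : R * R * R) (F : set (R * R * R)).
Hypotheses (hG : psl2_subgroup G) (hdisc : discrete_group G) (hP0 : H3 P0)
  (hstab : trivial_stabilizer G P0).
Implicit Types (g h : 'M[R[i]]_2) (u v : R * R * R).

Definition nontrivial : set 'M[R[i]]_2 := [set h | G h /\ ~ psl2_trivial h].

Lemma psl2_trivialV g : psl2_trivial g^-1 -> psl2_trivial g.
Proof.
by case=> /(congr1 GRing.inv); rewrite invrK ?invrN invr1; [left|right].
Qed.

Lemma nontrivialV g : nontrivial g -> nontrivial g^-1.
Proof.
move=> [Gg ntg]; have [_ _ _ _ GV] := hG; split; first exact: GV.
by move=> /psl2_trivialV.
Qed.

Lemma nontrivial_not_fix g : G g -> ~ fixes_infty g -> nontrivial g.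
Proof.
move=> Gg nfg; split=> // -[] gE; apply: nfg; rewrite /fixes_infty gE !mxE //.
by rewrite oppr0.
Qed.

Lemma gap_center_gt0 h : nontrivial h -> 0 < aeval (gap P0 h) (klein P0).
Proof.
move=> /[dup] /nontrivialV[Ghi nthi] [Gh _]; have [_ Gdet _ _ _] := hG.
rewrite aeval_gap subr_gt0; apply: Phi_center_gt => //; first exact: Gdet.
by move=> /(hstab Ghi).
Qed.

Hypothesis hF : F = dirichlet_domain G P0.

Lemma dirichletE u :
  F u <-> H3 u /\ forall h, nontrivial h -> 0 <= aeval (gap P0 h) (klein u).
Proof.
have [_ Gdet _ _ _] := hG; rewrite hF; split=> -[u0 uF]; split=> // h.
  move=> /nontrivialV[Gh nth]; have := uF _ Gh nth.
  by rewrite hdist_act_le ?Gdet // invrK aeval_gap subr_ge0.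
move=> Gh nth; have := uF _ (nontrivialV (conj Gh nth)).
by rewrite hdist_act_le ?Gdet // aeval_gap subr_ge0.
Qed.

Definition dirichlet_face h : set (R * R * R) :=
  F `&` [set u | aeval (gap P0 h) (klein u) = 0].

Lemma hconvex_dirichlet_face h : hconvex (dirichlet_face h).
Proof.
split=> [u [/dirichletE[]//]|P Q [/dirichletE[HP PF] P0'] [/dirichletE[HQ QF] Q0] u Hu].
split.
  apply/dirichletE; split=> [|k nk]; first exact: Hu.1.
  by apply: aeval_hsegment HP HQ Hu _ _; [exact: PF|exact: QF].
apply/eqP; rewrite /= eq_le; apply/andP; split.
  rewrite -oppr_ge0 -mulN1r -aevalZ4; apply: aeval_hsegment HP HQ Hu _ _.
    by rewrite aevalZ4 P0' mulr0.
  by rewrite aevalZ4 Q0 mulr0.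
by apply: aeval_hsegment HP HQ Hu _ _; rewrite ?P0' ?Q0.
Qed.

(** Moving from u straight away from P0 makes the gap of h negative at once, since it is zero at u
    and positive at P0; so u is not interior. *)
Lemma dirichlet_face_bd h : nontrivial h -> dirichlet_face h `<=` bd F.
Proof.
move=> nh u [Fu uh]; split=> // Fint; have /dirichletE[u0 _] := Fu.
pose w := vdiff (klein u) (klein P0).
have [e0 /andP[e0_gt0 _] e0P] := ray_kdomain w (klein_kdomain u0).
have Fnear : \forall e \near 0^'+, F (unklein (ray (klein u) w e)).
  exact: (@unklein_ray_cvg _ u w u0 F Fint).
have : \forall e \near (0 : R)^'+, False.
  near=> e.
  have e_gt0 : 0 < e by [].
  have Ue : kdomain (ray (klein u) w e).
    rewrite /kdomain /= -subr_gt0; apply: lt_le_trans (e0P e _).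
      by rewrite divr_gt0 // subr_gt0 klein_kdomain.
    by rewrite ltW //=; near: e; exact: nbhs_right_le.
  have /dirichletE[_ /(_ h nh)] : F (unklein (ray (klein u) w e)) by near: e.
  rewrite unkleinK // aeval_ray alin_diff uh !add0r mulrN oppr_ge0.
  by apply/negP; rewrite -ltNge mulr_gt0 // gap_center_gt0.
by move=> /filter_ex[].
Unshelve. all: by end_near.
Qed.

(** Its zero set in affine coordinates is the isometric sphere |cP + d| = 1 when c is nonzero;
    nonnegativity is the Ford inequality. *)
Definition iso_gap g : R * R * R * R := vadd4 (psi (g 1 0) (g 1 1)) (-1, 0, 0, 0).

Lemma aeval_iso_gap g v : aeval (iso_gap g) v = aeval (psi (g 1 0) (g 1 1)) v - 1.
Proof. by rewrite aevalD4; congr (_ + _); rewrite /aeval /= !mul0r !addr0. Qed.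

Hypothesis hford : forall g u, G g -> ~ fixes_infty g -> F u ->
  0 <= aeval (iso_gap g) (klein u).

Lemma not_fixes_inftyV g : G g -> ~ fixes_infty g -> ~ fixes_infty g^-1.
Proof.
move=> Gg nfg; have [_ Gdet _ _ _] := hG; rewrite /fixes_infty.
have [_ _ -> _] := invmx22E (Gdet _ Gg).
by move=> /eqP; rewrite oppr_eq0 => /eqP.
Qed.

Lemma side_in_face g u : G g -> ~ fixes_infty g -> (F `&` act g @` F) u ->
  dirichlet_face g^-1 u /\ aeval (iso_gap g^-1) (klein u) = 0.
Proof.
move=> Gg nfg [Fu [v Fv gvu]]; have [_ Gdet _ _ GV] := hG.
have dg := Gdet _ Gg; have /dirichletE[v0 vF] := Fv; have /dirichletE[u0 uF] := Fu.
have n0 := psi_gt0 dg v0; have n1 := hford Gg nfg Fv.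
have m1 := hford (GV _ Gg) (not_fixes_inftyV Gg nfg) Fu.
rewrite !aeval_iso_gap !subr_ge0 in n1 m1.
have nt := nontrivial_not_fix Gg nfg.
have ug := uF _ (nontrivialV nt); have vg := vF _ nt.
rewrite aeval_gap subr_ge0 in vg.
have [i00 i01 i10 i11] := invmx22E dg.
have gu : g \is a GRing.unit by rewrite unitmxE dg unitr1.
split.
  (* The Dirichlet inequality at v for g becomes, transported by g, the reverse of the inequality at
     u for g^-1. *)
  split=> //; apply/eqP; rewrite /= eq_le ug andbT aeval_gap subr_le0.
  rewrite -(ler_pM2r n0) -gvu !Phi_act // mulVr // mul1r //.
apply/eqP; rewrite aeval_iso_gap subr_eq0 eq_le m1 andbT.
(* By the cocycle rule the Ford quantities of g at v and of g^-1 at u have product 1; both are at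
   least 1, so both equal 1. *)
have := psi_act (g^-1 1 0) (g^-1 1 1) dg v0; rewrite gvu.
have -> : aeval (psi (g^-1 1 0 * g 0 0 + g^-1 1 1 * g 1 0)
    (g^-1 1 0 * g 0 1 + g^-1 1 1 * g 1 1)) (klein v) = 1.
  rewrite i10 i11; have -> : - g 1 0 * g 0 0 + g 0 0 * g 1 0 = 0 by ring.
  have -> : - g 1 0 * g 0 1 + g 0 0 * g 1 1 = \det g by rewrite det_mx22; ring.
  by rewrite dg psiE /sqn /= !mul0r add0r; ring.
move=> E; rewrite leNgt; apply/negP => lt1.
have x0 : 0 <= aeval (psi (g^-1 1 0) (g^-1 1 1)) (klein u) by rewrite (le_trans ler01).
by have := lt_le_trans lt1 (ler_peMr x0 n1); rewrite E ltxx.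
Qed.

(** The side lies in the face of g^-1, which is convex and contained in the boundary, so maximality
    identifies it with that face and with any face containing it. The isometric form vanishes on
    this maximal face, hence is proportional to the gap. *)
Lemma side_span g : side_pairing G F g -> ~ fixes_infty g ->
  exists2 lam : R, lam != 0 &
    forall v, aeval (gap P0 g^-1) v = lam * aeval (iso_gap g^-1) v.
Proof.
move=> [Gg [S0 Sconv Sbd Smax]] nfg; have [_ Gdet _ _ GV] := hG.
have nt := nontrivialV (nontrivial_not_fix Gg nfg).
set S := F `&` _ in S0 Sconv Sbd Smax.
have Sface : S `<=` dirichlet_face g^-1 by move=> u /(side_in_face Gg nfg)[].
have Smax' h : nontrivial h -> S `<=` dirichlet_face h -> dirichlet_face h = S.
  by move=> nh; apply: Smax; [exact: hconvex_dirichlet_face|exact: dirichlet_face_bd].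
have SE := Smax' _ nt Sface.
pose kface := face (gap P0) nontrivial (@kdomain R).
have faceP h u : H3 u -> (dirichlet_face h u <-> kface h (klein u)).
  move=> u0; split=> [[/dirichletE[_ uF] uh]|[[_ uF] uh]]; split=> //.
    by split; first exact: klein_kdomain.
  exact/dirichletE.
have SH3 u : S u -> H3 u by case=> /dirichletE[].
have facePv h v : kface h v -> dirichlet_face h (unklein v).
  move=> hv; have Uv : kdomain v by have [[]] := hv.
  by apply/faceP; rewrite ?unkleinK //; exact: unklein_H3.
have [_ _ i10 _] := invmx22E (Gdet _ Gg).
have span := @maximal_face_spans R _ (gap P0) nontrivial
  (@kdomain R) (klein P0) gap_center_gt0 (@kdomain_mid R) _ g^-1 (iso_gap g^-1) nt.
have {}span v : aeval (gap P0 g^-1) (klein P0) * aeval (iso_gap g^-1) v =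
    aeval (iso_gap g^-1) (klein P0) * aeval (gap P0 g^-1) v.
  apply: span => [p w Up||i ni sub x xi|x xF].
  - have [J J0 [e0 e0_gt0 e0P]] := gap_locally_finite w hG hdisc hP0 Up.
    exists J; first by move=> i [Gi _]; exact: J0.
    exists e0 => // e /e0P[Ur rJ]; split=> // i [Gi _]; exact: rJ.
  - have [u Su] := S0; exists (klein u); apply/faceP; first exact: SH3.
    exact: Sface.
  - have Ux : kdomain x by have [[]] := xi.
    have := facePv _ _ xi; rewrite (Smax' i ni) => [Sx|u Su].
      rewrite -(unkleinK Ux); apply/faceP; first exact: unklein_H3.
      exact: Sface.
    by apply/faceP; [exact: SH3|apply: sub; apply/faceP; [exact: SH3|exact: Sface]].
  - have : S (unklein x) by rewrite -SE; exact: facePv.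
    have Ux : kdomain x by have [[]] := xF.
    by move=> /(side_in_face Gg nfg)[_]; rewrite unkleinK.
have k0 := gap_center_gt0 nt.
set k := aeval _ _ in span k0; set l := aeval (iso_gap _) (klein P0) in span.
(* Otherwise the isometric form vanishes identically, yet its coefficient of N is |c|^2, which is
   nonzero. *)
have l0 : l != 0.
  apply/eqP => l0; have iso0 v : aeval (iso_gap g^-1) v = 0.
    by apply: (mulfI (lt0r_neq0 k0)); rewrite span l0 mul0r mulr0.
  have := iso0 (0, 0, 1); have := iso0 (0, 0, 0).
  rewrite /aeval /= !mulr0 !addr0 mulr1 => -> /eqP.
  by rewrite add0r sqn_eq0 i10 oppr_eq0 => /eqP.
exists (k / l); first by rewrite mulf_neq0 ?invr_eq0 // lt0r_neq0.
move=> v; apply: (mulfI l0); rewrite -span; field; exact: l0.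
Qed.
End Sides.

(** * Elements whose bisector is their isometric sphere *)

Section IsometricBisector.
Context {R : realType}.
Implicit Types (g h : 'M[R[i]]_2) (P v : R * R * R) (z : R[i]).

(* Klein coordinates centred at [z0]; [tau] is the squared height. *)
Definition kpoint (z0 z : R[i]) (tau : R) : R * R * R :=
  (complex.Re (z0 + z), complex.Im (z0 + z), sqn (z0 + z) + tau).

Lemma psi_kpoint (p q z0 z : R[i]) (tau : R) :
  aeval (psi p q) (kpoint z0 z tau) = sqn (p * z + (p * z0 + q)) + sqn p * tau.
Proof.
rewrite psiE; congr (sqn _ + _ * _); last by rewrite /kpoint /sqn /=; ring.
rewrite /kpoint; have -> : zpart (complex.Re (z0 + z), complex.Im (z0 + z),
  sqn (z0 + z) + tau) = z0 + z by rewrite /zpart /=; case: (z0 + z).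
by ring.
Qed.

Lemma kpointE (z0 : R[i]) (v : R * R * R) :
  v = kpoint z0 (zpart v - z0) (v.2 - sqn (zpart v)).
Proof. by case: v => [[x y] N]; rewrite /kpoint addrC subrK addrC subrK. Qed.

Lemma gap_kpoint P0 h z tau (z0 := zpart P0) :
  aeval (gap P0 h) (kpoint z0 z tau) =
  sqn ((h 0 0 - z0 * h 1 0) * z
       + ((h 0 0 - z0 * h 1 0) * z0 + (h 0 1 - z0 * h 1 1)))
  + sqn (h 0 0 - z0 * h 1 0) * tau
  + P0.2 ^+ 2 * (sqn (h 1 0 * z + (h 1 0 * z0 + h 1 1)) + sqn (h 1 0) * tau)
  - (sqn z + tau + P0.2 ^+ 2).
Proof.
rewrite aeval_gap !aevalPhi !psi_kpoint -/z0; congr (_ - _).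
by rewrite !mxE; move: z0 z => [x y] [x' y']; rewrite /sqn /=; ring.
Qed.

(* Comparing coefficients in [gap P0 h = lam * iso_gap h], in coordinates
   centred below P0. *)
Lemma gap_iso_coef P0 h (lam : R) (z0 := zpart P0) (A := h 0 0 - z0 * h 1 0)
    (B := A * z0 + (h 0 1 - z0 * h 1 1)) (D := h 1 0 * z0 + h 1 1)
    (mu := lam - P0.2 ^+ 2) :
  \det h = 1 -> h 1 0 != 0 ->
  (forall v, aeval (gap P0 h) v = lam * aeval (iso_gap h) v) ->
  [/\ A = D^*%C, sqn A - 1 = mu * sqn (h 1 0) & B = mu%:C%C * (h 1 0)^*%C].
Proof.
move=> dh c0 gapE.
have E z tau : sqn (A * z + B) + sqn A * tau - sqn z - tau =
    mu * (sqn (h 1 0 * z + D) + sqn (h 1 0) * tau) - lam + P0.2 ^+ 2.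
  have := gapE (kpoint z0 z tau); rewrite aeval_iso_gap gap_kpoint psi_kpoint.
  by rewrite -/A -/B -/D /mu; lra.
have dABD : A * D - B * h 1 0 = 1.
  rewrite -[RHS]dh det_mx22 /B /D /A.
  ring.
have sqn0 : sqn (0 : R[i]) = 0 by rewrite /sqn /= expr0n addr0.
(* Comparison of the coefficients of tau. *)
have E1 : sqn A - 1 = mu * sqn (h 1 0).
  have := E 0 0; have := E 0 1; rewrite !mulr0 !add0r !mulr1 sqn0; lra.
(* The four values z = 1, -1, i, -i isolate the terms linear in z. *)
have E2 : A * B^*%C = mu%:C%C * (h 1 0 * D^*%C).
  have := E 1 0; have := E (- 1) 0; have := E 'i%C 0; have := E (- 'i%C) 0.
  move: (A) (B) (D) (h 1 0) => [a1 a2] [b1 b2] [d1 d2] [c1 c2].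
  rewrite /sqn /= => e1 e2 e3 e4; apply: complex_eq => /=; lra.
have sqnC x : (sqn x)%:C%C = x * x^*%C.
  by case: x => x y; apply: complex_eq; rewrite /sqn /=; ring.
have E1C : A * A^*%C - 1 = mu%:C%C * (h 1 0 * (h 1 0)^*%C).
  by rewrite -!sqnC -rmorphM -E1 rmorphB rmorph1.
have dC : A^*%C * D^*%C - B^*%C * (h 1 0)^*%C = 1.
  by have := congr1 (fun x : R[i] => x^*%C) dABD; rewrite rmorphB !rmorphM rmorph1.
(* Multiply the conjugated determinant relation by A and substitute [E2]: what remains is (|A|^2 -
   mu |c|^2) conj D, whose factor is 1 by [E1]. *)
have AD : A = D^*%C.
  transitivity (A * (A^*%C * D^*%C - B^*%C * (h 1 0)^*%C)); first by rewrite dC mulr1.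
  transitivity ((A * A^*%C) * D^*%C - (A * B^*%C) * (h 1 0)^*%C); first by ring.
  rewrite E2; transitivity ((A * A^*%C - 1 - mu%:C%C * (h 1 0 * (h 1 0)^*%C)) * D^*%C + D^*%C).
    by ring.
  by rewrite E1C subrr mul0r add0r.
split=> //; apply: (mulIf c0).
have -> : B * h 1 0 = A * D - 1 by rewrite -dABD; ring.
have -> : D = A^*%C by rewrite AD conjcK.
by rewrite E1C; ring.
Qed.

(** Inverting the normal form (A, mu conj c; c, conj A) conjugates A and negates the off-diagonal
    entries, so the same relation holds with the same [lam]. *)
Lemma gap_iso_inv P0 g (lam : R) :
  \det g = 1 -> g^-1 1 0 != 0 ->
  (forall v, aeval (gap P0 g^-1) v = lam * aeval (iso_gap g^-1) v) ->
  forall v, aeval (gap P0 g) v = lam * aeval (iso_gap g) v.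
Proof.
move=> dg c0 gapE v; have dgi : \det g^-1 = 1 by rewrite det_inv dg invr1.
have [i00 i01 i10 i11] := invmx22E dg.
have [] := gap_iso_coef dgi c0 gapE; rewrite i00 i01 i10 i11 => AD E1 BE.
rewrite (kpointE (zpart P0) v).
move: (zpart v - zpart P0) (v.2 - sqn (zpart v)) => z tau.
rewrite aeval_iso_gap gap_kpoint psi_kpoint; move: AD E1 BE; set z0 := zpart P0.
set A := g 1 1 - _ => AD E1 BE.
have AC : A^*%C = - g 1 0 * z0 + g 0 0 by rewrite AD conjcK.
have -> : g 1 0 * z0 + g 1 1 = A by rewrite /A; ring.
have -> : g 0 0 - z0 * g 1 0 = A^*%C.
  by rewrite AC; ring.
have -> : A^*%C * z0 + (g 0 1 - z0 * g 1 1) = - ((lam - P0.2 ^+ 2)%:C%C * (- g 1 0)^*%C).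
  by rewrite -BE AC /A; ring.
move: E1; rewrite sqnN => E1; clear -E1.
have {E1} : sqn A = 1 + (lam - P0.2 ^+ 2) * sqn (g 1 0) by lra.
move: (A) (g 1 0) (z) => [a1 a2] [c1 c2] [x y] E1.
apply/eqP; rewrite -subr_eq0; apply/eqP.
(* The difference of the two sides factors as (|A|^2 - 1 - mu |c|^2)(|z|^2 + tau - mu). *)
transitivity ((sqn (a1 +i* a2)%C - (1 + (lam - P0.2 ^+ 2) * sqn (c1 +i* c2)%C)) *
   (sqn (x +i* y)%C + tau - (lam - P0.2 ^+ 2))).
  by rewrite /sqn /=; ring.
by rewrite E1 subrr mul0r.
Qed.

Lemma trace_real P0 h (lam : R) : \det h = 1 -> h 1 0 != 0 ->
  (forall v, aeval (gap P0 h) v = lam * aeval (iso_gap h) v) ->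
  h 0 0 + h 1 1 \is Num.real.
Proof.
move=> dh c0 /(gap_iso_coef dh c0)[AD _ _].
have -> : h 0 0 + h 1 1 = (h 0 0 - zpart P0 * h 1 0) + (h 1 0 * zpart P0 + h 1 1) by ring.
by rewrite AD; case: (h 1 0 * zpart P0 + h 1 1) => a b; rewrite complex_real /= addNr.
Qed.

(** As [lam] is nonzero, the bisector is the isometric sphere of g, of centre -d/c and radius
    1/|c|. *)
Lemma hemisphere_bisector P0 g (lam : R) : H3 P0 -> \det g = 1 -> g 1 0 != 0 ->
  lam != 0 -> (forall v, aeval (gap P0 g) v = lam * aeval (iso_gap g) v) ->
  hemisphere_centered (bisector P0 g) (- (g 1 1 / g 1 0)).
Proof.
move=> P00 dg c0 lam0 gapE; have dgi : \det g^-1 = 1 by rewrite det_inv dg invr1.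
have s0 : 0 < sqn (g 1 0) by rewrite lt0r sqn_ge0 sqn_eq0 c0.
exists (Num.sqrt (sqn (g 1 0))^-1); first by rewrite sqrtr_gt0 invr_gt0.
have sph u : (Normc.normc (zpart u - - (g 1 1 / g 1 0)) ^+ 2 + u.2 ^+ 2) * sqn (g 1 0) =
    aeval (psi (g 1 0) (g 1 1)) (klein u).
  rewrite normc_sqr -/(sqn _) psiE opprK mulrDl -sqnM.
  have -> : (zpart u + g 1 1 / g 1 0) * g 1 0 = g 1 0 * zpart u + g 1 1.
    by rewrite mulrDl mulfVK // mulrC.
  by rewrite /klein /=; congr (_ + _); ring.
rewrite sqr_sqrtr ?invr_ge0 ?sqn_ge0 //.
apply/seteqP; split=> u [u0 /= uE]; split=> //.
  move/hdist_act_eq: uE => /(_ dgi P00 u0); rewrite invrK => uE.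
  apply: (mulIf (lt0r_neq0 s0)); rewrite sph mulVf ?lt0r_neq0 //.
  have := gapE (klein u); rewrite aeval_gap uE subrr => /esym/eqP.
  by rewrite mulf_eq0 (negPf lam0) /= aeval_iso_gap subr_eq0 => /eqP.
apply/hdist_act_eq => //; rewrite invrK; apply/esym/eqP; rewrite -subr_eq0 -aeval_gap gapE.
by rewrite aeval_iso_gap -sph uE mulVf ?lt0r_neq0 // subrr mulr0.
Qed.

End IsometricBisector.

(** * The stabilizer of infinity *)

Lemma parabolic_infty (R : realType) (p : 'M[R[i]]_2) :
  \det p = 1 -> parabolic p -> fixes_infty p ->
  [/\ p 1 1 = p 0 0, p 0 0 = 1 \/ p 0 0 = -1 & p 0 1 != 0].
Proof.
rewrite det_mx22 /parabolic /fixes_infty => dp [ntp trp] p0.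
rewrite p0 mulr0 subr0 in dp; rewrite mxtrace22 in trp.
(* For a triangular matrix (d - a)^2 is the discriminant tr^2 - 4 det, here zero. *)
have pE : p 1 1 = p 0 0.
  apply/eqP; rewrite -subr_eq0 -sqrf_eq0.
  have -> : (p 1 1 - p 0 0) ^+ 2 = (p 0 0 + p 1 1) ^+ 2 - 4 * (p 0 0 * p 1 1) by ring.
  by rewrite trp dp mulr1 subrr.
have aE : p 0 0 = 1 \/ p 0 0 = -1.
  have /eqP : p 0 0 ^+ 2 = 1 by rewrite expr2 -{2}pE.
  by rewrite sqrf_eq1 => /orP[] /eqP; [left|right].
split=> //; apply/eqP => b0; apply: ntp.
have scal (x : R[i]) : p 0 0 = x -> p = x%:M.
  move=> px; apply/matrixP => i j; rewrite !mxE.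
  by case: (ord2P i) => ->; case: (ord2P j) => ->; rewrite ?b0 ?p0 ?pE ?px.
case: aE => /scal->; [by left|right].
by rewrite rmorphN rmorph1.
Qed.

(* Conjugating a parabolic translation by powers of a contracting element of the
   stabilizer gives nontrivial translations converging to the identity. *)
Lemma stab_infty_not_contracting (R : realType) (G : set 'M[R[i]]_2) (g : 'M[R[i]]_2) :
  psl2_subgroup G -> discrete_group G ->
  (exists g, [/\ G g, parabolic g & fixes_infty g]) ->
  G g -> fixes_infty g -> 1 <= sqn (g 0 0).
Proof.
move=> hG hdisc [p [Gp parp p0]] Gg g0; rewrite leNgt; apply/negP => lt1.
have [G1 Gdet GN GM GV] := hG.
have dg := Gdet _ Gg; have dp := Gdet _ Gp.
have [pE aE b0] := parabolic_infty dp parp p0.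
have [i00 i01 i10 i11] := invmx22E dg.
rewrite /fixes_infty in g0 p0; rewrite det_mx22 g0 mulr0 subr0 in dg.
have a0 : g 0 0 != 0.
  by apply/eqP => a0; move: dg; rewrite a0 mul0r => /esym/eqP; rewrite oner_eq0.
(* Each conjugation by g multiplies the upper right entry by a^2 and leaves the diagonal
   unchanged. *)
have conj n : exists q, [/\ G q, q 0 0 = p 0 0, q 1 1 = p 0 0, q 1 0 = 0
    & q 0 1 = (g 0 0 ^+ 2) ^+ n * p 0 1].
  elim: n => [|n [q [Gq q00 q11 q10 q01]]]; first by exists p; rewrite mul1r.
  exists (g * q * g^-1); rewrite !mulmx22E i00 i01 i10 i11 q00 q11 q10 q01 g0.
  split; first by apply: (GM); [exact: GM|exact: GV].
  - transitivity (p 0 0 * (g 0 0 * g 1 1)); first by ring.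
    by rewrite dg mulr1.
  - transitivity (p 0 0 * (g 0 0 * g 1 1)); first by ring.
    by rewrite dg mulr1.
  - by ring.
  - by rewrite [_ ^+ n.+1]exprS; move: ((g 0 0 ^+ 2) ^+ n) => X; ring.
(* The conjugates approach this scalar matrix, plus or minus the identity, which is isolated in
   G. *)
have Ga : G (p 0 0)%:M.
  by case: aE => ->; [|rewrite rmorphN; apply: GN]; rewrite rmorph1.
have [e e0 He] := hdisc _ Ga.
have sX (x : R[i]) n : sqn (x ^+ n) = sqn x ^+ n.
  elim: n => [|n IH]; first by rewrite !expr0 /sqn /= expr0n expr1n addr0.
  by rewrite !exprS sqnM IH.
have [n nP] : exists n, (sqn (g 0 0) ^+ 2) ^+ n * sqn (p 0 1) < e ^+ 2.
  have s0 : 0 < sqn (p 0 1) by rewrite lt0r sqn_ge0 sqn_eq0 b0.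
  have e2 : 0 < e ^+ 2 / sqn (p 0 1) by rewrite divr_gt0 // exprn_gt0.
  have c1 : `|sqn (g 0 0) ^+ 2| < 1.
    by rewrite ger0_norm ?exprn_ge0 ?sqn_ge0 // exprn_ilt1 ?sqn_ge0.
  have [N _ NP] := cvgr_lt 0 (cvg_expr c1) _ e2.
  by exists N; rewrite -ltr_pdivlMr //; apply: NP => /=.
have [q [Gq q00 q11 q10 q01]] := conj n.
have qE : q = (p 0 0)%:M.
  apply: He => // i j; rewrite !mxE.
  have n0 : Normc.normc (0 : R[i]) < e by rewrite Normc.normc0.
  case: (ord2P i) => ->; case: (ord2P j) => -> /=; rewrite ?q00 ?q11 ?q10 ?subrr ?subr0 //.
  rewrite q01 -(ltr_pXn2r (n := 2)) ?nnegrE ?(ltW e0) //; last first.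
    by case: (_ * _) => ? ?; exact: sqrtr_ge0.
  by rewrite normc_sqr -/(sqn _) sqnM !sX.
move: q01; rewrite qE !mxE /= => /esym/eqP.
by rewrite mulf_eq0 !expf_eq0 (negPf a0) (negPf b0) !andbF.
Qed.

(** Inversion swaps the diagonal entries, so both have modulus at least 1, while their product is
    1. *)
Lemma stab_infty_norm1 (R : realType) (G : set 'M[R[i]]_2) (g : 'M[R[i]]_2) :
  psl2_subgroup G -> discrete_group G ->
  (exists g, [/\ G g, parabolic g & fixes_infty g]) ->
  G g -> fixes_infty g -> sqn (g 0 0) = 1.
Proof.
move=> hG hdisc hpar Gg g0; have [_ Gdet _ _ GV] := hG.
have dg := Gdet _ Gg; have [i00 _ i10 _] := invmx22E dg.
have g1 := stab_infty_not_contracting hG hdisc hpar Gg g0.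
have gi0 : fixes_infty g^-1 by rewrite /fixes_infty i10 g0 oppr0.
have := stab_infty_not_contracting hG hdisc hpar (GV _ Gg) gi0; rewrite i00 => g2.
have E : sqn (g 0 0) * sqn (g 1 1) = 1.
  rewrite -sqnM; have -> : g 0 0 * g 1 1 = 1 by rewrite -dg det_mx22 g0 mulr0 subr0.
  by rewrite /sqn /= expr1n expr0n addr0.
apply/eqP; rewrite eq_le g1 andbT -E ler_peMr // sqn_ge0 //.
Qed.

(** * Real traces and the common vertical axis *)

Theorem corollary4p4 (R : realType) (G : set 'M[R[i]]_2)
    (P0 : R * R * R) (F : set (R * R * R))
    (hG : psl2_subgroup G) (hdisc : discrete_group G)
    (hncc : ~ cocompact G) (hcof : cofinite G)
    (hpar : exists g, [/\ G g, parabolic g & fixes_infty g])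
    (hP0 : H3 P0) (hstab : trivial_stabilizer G P0)
    (hDF : DF_domain G P0 F) :
  (forall g, side_pairing G F g -> \tr g \is Num.real) /\
  (exists z0 : R[i], forall g, side_pairing G F g -> ~ fixes_infty g ->
     exists z1 z2 : R[i],
       [/\ hemisphere_centered (bisector P0 g) z1,
           hemisphere_centered (bisector P0 g^-1) z2
         & z1 <> z2 -> vertical_line z0 `<=` bisecting_plane z1 z2]).
Proof.
have [hF [Finf _ FE]] := hDF; have [_ Gdet _ _ GV] := hG.
have hford g u : G g -> ~ fixes_infty g -> F u -> 0 <= aeval (iso_gap g) (klein u).
  move=> Gg nfg; rewrite FE => -[_ /(_ g Gg nfg)].
  by rewrite qden_psi aeval_iso_gap subr_ge0.
have span := side_span hG hdisc hP0 hstab hF hford.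
have c_neq0 (g : 'M[R[i]]_2) : ~ fixes_infty g -> g 1 0 != 0 by move=> /eqP.
split.
  move=> g /[dup] Sg [Gg _]; rewrite mxtrace22; have dg := Gdet _ Gg.
  have [gfix|nfg] := pselect (fixes_infty g).
    have n1 := stab_infty_norm1 hG hdisc hpar Gg gfix.
    have : g 0 0 * g 1 1 = 1 by rewrite -dg det_mx22 gfix mulr0 subr0.
    move: n1; case: (g 0 0) (g 1 1) => a1 a2 [d1 d2]; rewrite /sqn /= => n1.
    move=> /[dup] /(congr1 (@complex.Re R)) + /(congr1 (@complex.Im R)) => /= dr di.
    rewrite complex_real; apply/eqP.
    (* From |a| = 1 and a d = 1 it follows that d = conj a; this is the imaginary part of a + d
       written out. *)
    transitivity (a2 + d2 * (a1 ^+ 2 + a2 ^+ 2)); first by rewrite n1 mulr1.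
    transitivity (a2 * (1 - (a1 * d1 - a2 * d2)) + a1 * (a1 * d2 + a2 * d1)); first by ring.
    by rewrite dr di subrr !mulr0 addr0.
  have [lam _ gapE] := span g Sg nfg.
  have dgi : \det g^-1 = 1 by rewrite det_inv dg invr1.
  have := trace_real dgi (c_neq0 _ (not_fixes_inftyV hG Gg nfg)) gapE.
  by have [-> _ _ ->] := invmx22E dg; rewrite addrC.
(* The axis is the vertical line through P0. *)
exists (zpart P0) => g /[dup] Sg [Gg _] nfg.
have dg := Gdet _ Gg; have dgi := Gdet _ (GV _ Gg).
have c0 := c_neq0 _ nfg; have ci0 := c_neq0 _ (not_fixes_inftyV hG Gg nfg).
have [lam lam0 gapE] := span g Sg nfg.
have gapE' := gap_iso_inv dg ci0 gapE.
exists (- (g 1 1 / g 1 0)), (- (g^-1 1 1 / g^-1 1 0)); split.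
- exact: hemisphere_bisector gapE'.
- exact: hemisphere_bisector gapE.
move=> _ u [u0 uz]; split=> //=; rewrite uz.
have [AD _ _] := gap_iso_coef dgi ci0 gapE.
have nE (x : R[i]) : Normc.normc x = Num.sqrt (sqn x) by case: x.
rewrite !nE; congr Num.sqrt; have [i00 i01 i10 i11] := invmx22E dg.
have s0 : sqn (g 1 0) != 0 by rewrite sqn_eq0.
(* Scaled by |c|^2, the squared distances from the point below P0 to the two centres are |A|^2 and
   |D|^2 for g^-1, which agree since A = conj D. *)
apply: (mulIf s0); rewrite -{2}(sqnN (g 1 0)) -i10 -!sqnM !opprK !mulrDl !mulfVK //.
have -> : zpart P0 * g 1 0 + g 1 1 = g^-1 0 0 - zpart P0 * g^-1 1 0.
  by rewrite i00 i10; ring.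
rewrite AD [_ * zpart P0]mulrC.
by case: (zpart P0 * _ + _) => ? ?; rewrite /sqn /= sqrrN.
Qed.
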